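(* Let $n \ge 6$ be an even number, let $\mathcal{R}=\mathbb{Z}[\tau_{ij}\mid 1\le i<j\le n]$, and let $\mathcal{T}$ be the generic $n\times n$ skew symmetric matrix over $\mathcal{R}$. The homomorphisms given by the matrices $$\partial_3 = \mathcal{T}[1\ldots n;4\ldots n],$$ $$\partial_2 = \begin{pmatrix} 0&0&0&-\operatorname{pf}(\overline{1234})&\operatorname{pf}(\overline{1235})&\cdots&-\operatorname{pf}(\overline{123n})\\ \operatorname{pf}(\overline{13})&-\operatorname{pf}(\overline{23})&0&\operatorname{pf}(\overline{34})&-\operatorname{pf}(\overline{35})&\cdots&\operatorname{pf}(\overline{3n})\\ -\operatorname{pf}(\overline{12})&0&\operatorname{pf}(\overline{23})&-\operatorname{pf}(\overline{24})&\operatorname{pf}(\overline{25})&\cdots&-\operatorname{pf}(\overline{2n})\\ 0&\operatorname{pf}(\overline{12})&-\operatorname{pf}(\overline{13})&\operatorname{pf}(\overline{14})&-\operatorname{pf}(\overline{15})&\cdots&\operatorname{pf}(\overline{1n})\end{pmatrix}$$ (in columns $j\ge 4$ the signs are $(-1)^{j-1}$ in rows $1$ and $3$ and $(-1)^j$ in rows $2$ and $4$), and $$\partial_1 = \begin{pmatrix}\operatorname{Pf}(\mathcal{T})&\operatorname{pf}(\overline{12})&\operatorname{pf}(\overline{13})&\operatorname{pf}(\overline{23})\end{pmatrix}$$ define an exact sequence $$\mathcal{F} = 0\longrightarrow \mathcal{R}^{n-3}\xrightarrow{\partial_3}\mathcal{R}^n\xrightarrow{\partial_2}\mathcal{R}^4\xrightarrow{\partial_1}\mathcal{R}.$$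 That is, denoting by $\mathfrak{A}_n$ the ideal generated by the entries of $\partial_1$, the complex $\mathcal{F}$ is a free resolution of $\mathcal{R}/\mathfrak{A}_n$. Moreover, the ideal $\mathfrak{A}_n$ is perfect of grade $3$.
   Context: $\mathcal{T}$ has entries $\mathcal{T}[i;j]=\tau_{ij}=-\mathcal{T}[j;i]$ for $1\le i<j\le n$ and zeros on the diagonal. $\mathcal{T}[1\ldots n;4\ldots n]$ is the submatrix of $\mathcal{T}$ consisting of all rows and of columns $4,\dots,n$. $\operatorname{Pf}(\mathcal{T})$ is the Pfaffian of $\mathcal{T}$ and $\operatorname{pf}(\overline{i_1\ldots i_k})$ denotes the Pfaffian of the submatrix of $\mathcal{T}$ obtained by removing the rows and columns with indices $i_1,\dots,i_k$ (the Pfaffian of the empty matrix is $1$). Exactness is meant at $\mathcal{R}^{n-3}$, $\mathcal{R}^n$ and $\mathcal{R}^4$. *)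

(* Defs.v *)
From HB Require Import structures.
From mathcomp Require Import all_boot all_order fingroup perm all_algebra.
From mathcomp Require Import boolp mpoly.

Set Implicit Arguments.
Unset Strict Implicit.
Unset Printing Implicit Defensive.

Import GRing.Theory.
Local Open Scope ring_scope.

(* Ideals of a commutative ring, the unit ideal being allowed (unlike
   [idealr] of ring_quotient, which imposes properness). *)
HB.mixin Record isMulAbsorbing (R : comNzRingType) (S : {pred R}) := {
  absorbM : forall a : R, {in S, forall x, a * x \in S}
}.

#[short(type="ideal")]
HB.structure Definition Ideal (R : comNzRingType) :=
  {S of GRing.ZmodClosed R S & isMulAbsorbing R S}.

Section IdealGen.
Variables (R : comNzRingType) (s : seq R).

Definition ideal_gen : {pred R} :=
  fun x => `[< exists c : 'I_(size s) -> R, x = \sum_i c i * s`_i >].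

Lemma ideal_genP x :
  reflect (exists c : 'I_(size s) -> R, x = \sum_i c i * s`_i)
          (x \in ideal_gen).
Proof. exact: asboolP. Qed.

Lemma ideal_gen_zmod : zmod_closed ideal_gen.
Proof.
split=> [|x y /ideal_genP[c ->] /ideal_genP[d ->]]; apply/ideal_genP.
  by exists (fun=> 0); rewrite big1 // => i _; rewrite mul0r.
exists (fun i => c i - d i); rewrite -sumrB.
by apply: eq_bigr => i _; rewrite mulrBl.
Qed.

Lemma ideal_gen_absorb (a : R) : {in ideal_gen, forall x, a * x \in ideal_gen}.
Proof.
move=> x /ideal_genP[c ->]; apply/ideal_genP; exists (fun i => a * c i).
by rewrite mulr_sumr; apply: eq_bigr => i _; rewrite mulrA.
Qed.

HB.instance Definition _ := GRing.isZmodClosed.Build R ideal_gen ideal_gen_zmod.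
HB.instance Definition _ := isMulAbsorbing.Build R ideal_gen ideal_gen_absorb.

End IdealGen.

Section QuotientModule.
Local Open Scope quotient_scope.
Variables (R : comNzRingType) (I : ideal R).

Definition quot_mod : Type := Quotient.quot I.

HB.instance Definition _ := GRing.Zmodule.on quot_mod.

Definition quot_pi (x : R) : quot_mod := \pi_(Quotient.quot I) x.

Definition quot_scale (a : R) (u : quot_mod) : quot_mod :=
  quot_pi (a * generic_quotient.repr (u : Quotient.quot I)).

Lemma quot_pi_eq x y : (quot_pi x = quot_pi y) <-> x - y \in I.
Proof.
by rewrite Quotient.idealrBE /quot_pi; split=> /eqP.
Qed.

Lemma quot_pi_surj (u : quot_mod) : exists x, quot_pi x = u.
Proof. by exists (generic_quotient.repr (u : Quotient.quot I)); apply: reprK. Qed.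

Lemma quot_piD : {morph quot_pi : x y / x + y}.
Proof. by move=> x y; rewrite /quot_pi piE. Qed.

Lemma quot_scale_pi a x : quot_scale a (quot_pi x) = quot_pi (a * x).
Proof.
apply/quot_pi_eq; rewrite -mulrBr; apply: absorbM.
by apply/quot_pi_eq; apply: reprK.
Qed.

Fact quot_scaleA a b u :
  quot_scale a (quot_scale b u) = quot_scale (a * b) u.
Proof. by case: (quot_pi_surj u) => x <-; rewrite !quot_scale_pi mulrA. Qed.

Fact quot_scale1 : left_id 1 quot_scale.
Proof. by move=> u; case: (quot_pi_surj u) => x <-; rewrite quot_scale_pi mul1r. Qed.

Fact quot_scaleDr : right_distributive quot_scale +%R.
Proof.
move=> a u v; case: (quot_pi_surj u) => x <-; case: (quot_pi_surj v) => y <-.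
by rewrite -quot_piD !quot_scale_pi mulrDr quot_piD.
Qed.

Fact quot_scaleDl u : {morph quot_scale^~ u : a b / a + b}.
Proof.
move=> a b; case: (quot_pi_surj u) => x <-.
by rewrite !quot_scale_pi mulrDl quot_piD.
Qed.

HB.instance Definition _ := GRing.Zmodule_isLmodule.Build R quot_mod
  quot_scaleA quot_scale1 quot_scaleDr quot_scaleDl.

Definition quot_aug (v : 'cV[R]_1) : quot_mod := quot_pi (v 0 0).

Fact quot_aug_linear : linear quot_aug.
Proof. by move=> a u v; rewrite /quot_aug !mxE quot_piD -quot_scale_pi. Qed.

HB.instance Definition _ :=
  GRing.isLinear.Build R 'cV[R]_1 quot_mod *:%R quot_aug quot_aug_linear.

End QuotientModule.

Section HomologicalNotions.
Variable R : comNzRingType.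

Definition exact_at (U V W : lmodType R) (f : {linear U -> V})
    (g : {linear V -> W}) : Prop :=
  forall v : V, g v = 0 <-> exists u : U, f u = v.

Definition projective (P : lmodType R) : Prop :=
  forall (M N : lmodType R) (g : {linear M -> N}) (f : {linear P -> N}),
    (forall y : N, exists x : M, g x = y) ->
  exists h : {linear P -> M}, forall x, g (h x) = f x.

(* ... -> P 2 -> P 1 -> P 0 -> M -> 0 is exact. *)
Definition resolution (M : lmodType R) (P : nat -> lmodType R)
    (d : forall k, {linear P k.+1 -> P k}) (e : {linear P 0%N -> M}) : Prop :=
  [/\ forall y : M, exists x, e x = y,
      exact_at (d 0%N) e
    & forall k, exact_at (d k.+1) (d k)].

(* A resolution by free modules R^(r k), whose elements are column vectors on
   which the matrices D k act by left multiplication. *)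
Definition free_resolution (M : lmodType R) (r : nat -> nat)
    (D : forall k, 'M[R]_(r k, r k.+1)) (e : {linear 'cV[R]_(r 0%N) -> M}) :
    Prop :=
  @resolution M (fun k => 'cV[R]_(r k)) (fun k => mulmx (D k)) e.

Definition proj_dim_le (M : lmodType R) (m : nat) : Prop :=
  exists (P : nat -> lmodType R) (d : forall k, {linear P k.+1 -> P k})
         (e : {linear P 0%N -> M}),
    [/\ resolution d e,
        forall k, projective (P k)
      & forall k, (m < k)%N -> forall x : P k, x = 0].

Definition proj_dim_eq (M : lmodType R) (m : nat) : Prop :=
  proj_dim_le M m /\ forall m', proj_dim_le M m' -> (m <= m')%N.

Definition regular_seq (s : seq R) : Prop :=
  1 \notin ideal_gen s /\
  forall k, (k < size s)%N -> forall y : R,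
    s`_k * y \in ideal_gen (take k s) -> y \in ideal_gen (take k s).

Definition grade_eq (I : ideal R) (g : nat) : Prop :=
  (exists s : seq R, [/\ {subset s <= I}, regular_seq s & size s = g]) /\
  forall s : seq R, {subset s <= I} -> regular_seq s -> (size s <= g)%N.

(* I is a proper ideal with grade I = pd_R (R/I) = g. *)
Definition perfect_of_grade (I : ideal R) (g : nat) : Prop :=
  [/\ 1 \notin I, grade_eq I g & proj_dim_eq (quot_mod I) g].

End HomologicalNotions.

(* Sum over the perfect matchings of the index set: a matching is encoded by
   the unique permutation s listing it as
     {s 0, s 1}, {s 2, s 3}, ...   with  s 0 < s 1, s 2 < s 3, ...
   and s 0 < s 2 < ...  For even n and even i, [ordS i] is i + 1; for odd n no
   permutation qualifies (ordS wraps around), and the sum is 0. *)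
Definition matching_perm n (s : 'S_n) : bool :=
  [forall i : 'I_n, ~~ odd i ==> (s i < s (ordS i))%N] &&
  [forall i : 'I_n, forall j : 'I_n,
     [&& ~~ odd i, ~~ odd j & (i < j)%N] ==> (s i < s j)%N].

Definition Pfaffian (R : comNzRingType) n (A : 'M[R]_n) : R :=
  \sum_(s : 'S_n | matching_perm s)
     (-1) ^+ s * \prod_(i < n | ~~ odd i) A (s i) (s (ordS i)).

(* The principal submatrix with the (increasing) rows and columns in A. *)
Definition principal_submx (R : Type) n (S : {set 'I_n}) (A : 'M[R]_n) :
    'M[R]_#|S| :=
  mxsub (@enum_val _ (mem S)) (@enum_val _ (mem S)) A.

Definition upair n : Type := {p : 'I_n * 'I_n | (p.1 < p.2)%N}.
HB.instance Definition _ n := Finite.on (upair n).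

Notation genring n := {mpoly int[#|{: upair n}|]}.

Section Generic.
Variable n : nat.

Definition tau (i j : 'I_n) : genring n :=
  if insub (i, j) is Some p then 'X_(enum_rank (p : upair n)) else 0.

Definition genskew : 'M[genring n]_n :=
  \matrix_(i, j) if (i < j)%N then tau i j
                 else if (j < i)%N then - tau j i else 0.

(* pf of genskew with the rows and columns in l removed; the indices in l are
   1-based. *)
Definition pfbar (l : seq nat) : genring n :=
  Pfaffian (principal_submx [set i : 'I_n | i.+1 \notin l] genskew).

Fact shift3_subproof (j : 'I_(n - 3)) : (3 + j < n)%N.
Proof. by rewrite -ltn_subRL. Qed.
Definition shift3 (j : 'I_(n - 3)) : 'I_n := Ordinal (shift3_subproof j).

Definition partial3 : 'M[genring n]_(n, n - 3) := colsub shift3 genskew.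

(* c is the 1-based column index. *)
Definition partial2_entry (i : 'I_4) (c : nat) : genring n :=
  if (c <= 3)%N then
    nth 0 (nth [::]
      [:: [:: 0;                 0;                   0                  ];
          [:: pfbar [:: 1; 3]%N; - pfbar [:: 2; 3]%N; 0                  ];
          [:: - pfbar [:: 1; 2]%N; 0;                 pfbar [:: 2; 3]%N  ];
          [:: 0;                 pfbar [:: 1; 2]%N;   - pfbar [:: 1; 3]%N]]
      i) c.-1
  else
    nth 0
      [:: (-1) ^+ c.-1 * pfbar [:: 1; 2; 3; c]%N;
          (-1) ^+ c    * pfbar [:: 3; c]%N;
          (-1) ^+ c.-1 * pfbar [:: 2; c]%N;
          (-1) ^+ c    * pfbar [:: 1; c]%N]
      i.

Definition partial2 : 'M[genring n]_(4, n) :=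
  \matrix_(i, j) partial2_entry i j.+1.

Definition partial1 : 'M[genring n]_(1, 4) :=
  \row_j [:: Pfaffian genskew; pfbar [:: 1; 2]%N; pfbar [:: 1; 3]%N;
             pfbar [:: 2; 3]%N]`_j.

Definition idealA : ideal (genring n) :=
  ideal_gen [seq partial1 0 j | j : 'I_4].

Definition F_rank (k : nat) : nat := nth 0%N [:: 1; 4; n; n - 3]%N k.

Definition F_diff (k : nat) : 'M[genring n]_(F_rank k, F_rank k.+1) :=
  match k with
  | 0%N => partial1
  | 1%N => partial2
  | 2%N => partial3
  | _ => 0
  end.

End Generic.

(* Main.v *)
Require Import Defs.
From HB Require Import structures.
From mathcomp Require Import all_boot all_order fingroup perm all_algebra.
From mathcomp Require Import boolp mpoly ring zify.

(** The argument replaces localization and depth criteria by explicit Pfaffian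
    identities together with one regular sequence.

    Write T for the generic skew matrix and pf(S) for the Pfaffian of its
    principal submatrix on S.  Pfaffians are treated as alternating functions
    of index sequences, defined by expansion along the first index
    ([pfaff_cons]).  Expanding pf(k :: s) pairs a row of signed cofactors with
    the row k of T ([sum_cofactor]), and alternation says that pf(k :: s) is 0
    or, up to sign, another principal Pfaffian.  Every row of partial2 is, up to
    sign, such a cofactor row ([partial2E]), so partial2 T can be computed
    entry by entry ([partial2_genskew]), and the matrix P of all signed
    submaximal Pfaffians satisfies P T = T P = Pf(T).

    Three consequences carry the exactness.  (1) partial2 T has zero columns
    from the fourth on, and its first three columns are Koszul relations between
    the entries d_0, d_1, d_2, d_3 of partial1; the first three columns of
    partial2 itself are the other Koszul relations.  Hence all of them lie in
    the image of partial2, and every d_i multiplies each cycle of R^4 into that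
    image ([annihilates_cycles]).  (2) Three rows of P are, up to sign, rows of
    partial2, so partial2 y = 0 forces Pf(T) y = T P y into the image of
    partial3 ([adj_rows0]).  (3) If the entries of partial3 x lie in an ideal, then so do
    the products of the entries of x by d_0, d_1, d_2 ([partial3_cancel]).
    If d_0, d_1, d_2 is a regular sequence, (2) and (3) permit division by
    Pf(T), which is exactness at R^n, and (1) and (3) give exactness at R^4 by
    comparing the two lifts of d_0 z and d_1 z modulo (d_0, d_1).

    Regularity of d_0, d_1, d_2 is read off leading monomials: polynomials whose
    leading monomials are pairwise coprime, with invertible leading
    coefficients, form a regular sequence ([lead_regular]).  The vertices are
    placed on a line at positions x_i, and the edge ij gets the weight
    (x_i - x_j)^2.  The parallelogram identity
      2 (x_i - x_j)^2 + 2 (x_i + x_j - c)^2 = (2 x_i - c)^2 + (2 x_j - c)^2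
    shows that a perfect matching of a set symmetric about c/2 has maximal
    weight exactly when all its edges have midpoint c/2.  The positions are
    chosen so that the three vertex sets are symmetric about three distinct
    centres, and matchings with distinct centres share no edge
    ([regular_partial1]).

    Finally all entries of T vanish at the origin, so partial3 has no left
    inverse.  A projective resolution of length at most 2 would provide one, by
    comparison with the free resolution ([split_of_short_resolution]); so would
    a regular sequence of length 4 in the ideal, by a descent along the dual
    complex ([cocycle_coboundary]). *)

Set Implicit Arguments.
Unset Strict Implicit.
Unset Printing Implicit Defensive.

Import GRing.Theory.
Local Open Scope ring_scope.

(** * Pfaffians of index sequences *)

Section SeqPfaffian.
Variables (R : comNzRingType) (I : eqType).
Implicit Types (A : I -> I -> R) (g h : seq I -> R) (s t u v w : seq I).

(** The alternating sum of A a s_k * g (s without its k-th entry).  The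
    continuation g accumulates the entries already passed, which makes both the
    recursion and the anticommutation of two expansions structural in s. *)
Fixpoint expand A a g s : R :=
  if s is b :: s' then A a b * g s' - expand A a (fun t => g (b :: t)) s'
  else 0.

(** The counter k is only fuel: any k at least the length of the sequence gives
    the same value. *)
Fixpoint pfaff_rec A k s : R :=
  match s, k with
  | [::], _ => 1
  | a :: s', k'.+1 => expand A a (pfaff_rec A k') s'
  | _ :: _, 0%N => 0
  end.

Definition pfaff A s := pfaff_rec A (size s) s.

Lemma eq_expand A a g h s :
    (forall t, size t = (size s).-1 -> g t = h t) ->
  expand A a g s = expand A a h s.
Proof.
elim: s g h => //= b s IHs g h gh; rewrite gh //; congr (_ - _).
case: s IHs gh => // c s IHs gh.
by apply: IHs => t tE; apply: gh; rewrite /= tE.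
Qed.

Lemma pfaff_rec_size A k s : (size s <= k)%N -> pfaff_rec A k s = pfaff A s.
Proof.
rewrite /pfaff; elim: k {-2}k (leqnn k) s => [|m IHm] k km s sk.
  by case: s sk => //; move: km; rewrite leqn0 => /eqP->.
case: s k sk km => [|a s] [|k] //=; rewrite !ltnS => sk km.
apply: eq_expand => t tE; have {}tE : (size t <= size s)%N.
  by rewrite tE leq_pred.
by rewrite IHm ?(leq_trans tE) // [RHS]IHm // (leq_trans sk).
Qed.

Lemma pfaff_cons A a s : pfaff A (a :: s) = expand A a (pfaff A) s.
Proof.
rewrite /pfaff /=; apply: eq_expand => t tE.
by apply: pfaff_rec_size; rewrite tE leq_pred.
Qed.

Lemma expand0 A a s : expand A a (fun=> 0) s = 0.
Proof. by elim: s => //= b s ->; rewrite mulr0 subr0. Qed.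

Lemma expandN A a g s : expand A a (fun t => - g t) s = - expand A a g s.
Proof.
by elim: s g => [|b s IHs] g /=; rewrite ?oppr0 // IHs mulrN opprB opprK addrC.
Qed.

Lemma expandB A a g h s :
  expand A a (fun t => g t - h t) s = expand A a g s - expand A a h s.
Proof.
elim: s g h => [|b s IHs] g h /=; first by rewrite subr0.
by rewrite IHs; ring.
Qed.

Lemma expandZ A a c g s :
  expand A a (fun t => c * g t) s = c * expand A a g s.
Proof.
elim: s g => [|b s IHs] g /=; first by rewrite mulr0.
by rewrite IHs; ring.
Qed.

Lemma expandE A a g s x0 :
  expand A a g s = \sum_(k < size s)
    (-1) ^+ k * (A a (nth x0 s k) * g (take k s ++ drop k.+1 s)).
Proof.
elim: s g => [|b s IHs] g /=; first by rewrite big_ord0.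
rewrite big_ord_recl /= drop0 mul1r IHs; congr (_ + _).
by rewrite -sumrN; apply: eq_bigr => k _; rewrite /bump /= add1n exprS; ring.
Qed.

(** Expanding along a and then along b removes the same pairs of entries as
    expanding in the other order, with opposite signs. *)
Lemma expand_anticomm A a b g s :
  expand A a (expand A b g) s = - expand A b (expand A a g) s.
Proof.
elim: s g => [|c s IHs] g /=; first by rewrite oppr0.
by rewrite !expandB !expandZ (IHs (fun t => g (c :: t))); ring.
Qed.

Lemma expand_twice A a g s : expand A a (expand A a g) s = 0.
Proof.
elim: s g => [|c s IHs] g //=.
by rewrite !expandB !expandZ (IHs (fun t => g (c :: t))); ring.
Qed.

(** Alternation is recorded for adjacent entries only, in a form stable under
    prefixing and under [expand].  The vanishing on a repeated entry is kept
    separately because 2 may be a zero divisor. *)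
Definition swap_odd g :=
  (forall u a b v, g (u ++ a :: b :: v) = - g (u ++ b :: a :: v)) /\
  (forall u a v, g (u ++ a :: a :: v) = 0).

Lemma swap_odd_cons g c : swap_odd g -> swap_odd (fun t => g (c :: t)).
Proof. by move=> [gA g0]; split=> u *; [apply: (gA (c :: u)) | apply: (g0 (c :: u))]. Qed.

Lemma swap_odd_expand A c g : swap_odd g -> swap_odd (expand A c g).
Proof.
move=> gP; split=> u.
  elim: u g gP => [|d u IHu] g gP a b v /=.
    have -> : expand A c (fun t => g (a :: b :: t)) v =
              - expand A c (fun t => g (b :: a :: t)) v.
      by rewrite -expandN; apply: eq_expand => t _; exact: (gP.1 [::]).
    by ring.
  by rewrite gP.1 (IHu _ (swap_odd_cons d gP)); ring.
elim: u g gP => [|d u IHu] g gP a v /=.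
  rewrite (@eq_expand _ _ _ (fun=> 0)) ?expand0; first by ring.
  by move=> t _; exact: (gP.2 [::]).
by rewrite gP.2 (IHu _ (swap_odd_cons d gP)); ring.
Qed.

Section Alternating.
Variable A : I -> I -> R.
Hypotheses (A0 : forall a, A a a = 0) (AN : forall a b, A b a = - A a b).

Lemma swap_odd_pfaff_rec k : swap_odd (pfaff_rec A k).
Proof.
elim: k => [|k IHk].
  by split=> [[|? ?] *|[|? ?] *] //=; rewrite oppr0.
split=> [[|c u] a b v|[|c u] a v] /=; first last.
- exact: (swap_odd_expand A c IHk).2.
- rewrite A0 mul0r sub0r; case: k {IHk} => [|k] /=; first by rewrite expand0 oppr0.
  by rewrite expand_twice oppr0.
- exact: (swap_odd_expand A c IHk).1.
case: k {IHk} => [|k] /=; first by rewrite !expand0 (AN a b); ring.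
by rewrite (expand_anticomm A a b) (AN a b); ring.
Qed.

Lemma swap_odd_pfaff : swap_odd (pfaff A).
Proof.
by split=> *; rewrite /pfaff !size_cat /=; [rewrite (swap_odd_pfaff_rec _).1
  |rewrite (swap_odd_pfaff_rec _).2].
Qed.

Lemma pfaff_move a u v :
  pfaff A (a :: u ++ v) = (-1) ^+ size u * pfaff A (u ++ a :: v).
Proof.
rewrite -[a :: _]cat0s -[u ++ a :: v]cat0s.
elim: u [::] => [|c u IHu] w; first by rewrite mul1r.
rewrite swap_odd_pfaff.1 -cat_rcons IHu cat_rcons /= exprS; ring.
Qed.

Lemma pfaff_dup a s : a \in s -> pfaff A (a :: s) = 0.
Proof.
case/splitPr=> u v; rewrite -[_ :: _]cat0s.
elim: u [::] => [|c u IHu] w; first exact: swap_odd_pfaff.2.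
by rewrite swap_odd_pfaff.1 -cat_rcons IHu oppr0.
Qed.

End Alternating.

Definition pfaff_cofactor A s c : R :=
  if c \in s then (-1) ^+ index c s * pfaff A (rem c s) else 0.

End SeqPfaffian.

(** Summing over all indices instead of positions turns the expansion of
    pf(k :: s) into a matrix product. *)
Lemma sum_cofactor (R : comNzRingType) (I : finType) (A : I -> I -> R) s k :
  uniq s -> \sum_c pfaff_cofactor A s c * A k c = pfaff A (k :: s).
Proof.
move=> us; rewrite pfaff_cons (expandE _ _ _ _ k).
rewrite (bigID (mem s)) /= addrC big1 ?add0r; last first.
  by move=> c /negbTE cs; rewrite /pfaff_cofactor cs mul0r.
rewrite -big_uniq // (big_nth k) big_mkord; apply: eq_bigr => i _.
rewrite /pfaff_cofactor mem_nth // index_uniq // remE index_uniq //; ring.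
Qed.


(** * Expansion of the sum over perfect matchings *)

Lemma matching_permP n (s : 'S_n) :
  reflect ((forall i : 'I_n, ~~ odd i -> (s i < s (ordS i))%N) /\
           (forall i j : 'I_n, ~~ odd i -> ~~ odd j -> (i < j)%N ->
              (s i < s j)%N))
          (matching_perm s).
Proof.
apply: (iffP andP) => [[/forallP h1 /forallP h2]|[h1 h2]].
  split=> [i oi|i j oi oj ij]; first by have /implyP := h1 i; apply.
  by have /forallP/(_ j)/implyP := h2 i; apply; rewrite oi oj ij.
split; apply/forallP => i; first by apply/implyP; apply: h1.
by apply/forallP => j; apply/implyP => /and3P[]; apply: h2.
Qed.

Lemma lift_perm_surj n i (s : 'S_n.+1) :
  exists s', s = lift_perm i (s i) s'.
Proof.
pose f k := odflt k (unlift (s i) (s (lift i k))).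
have fE k : lift (s i) (f k) = s (lift i k).
  rewrite /f; have /unlift_some[j -> ->] // : s i != s (lift i k).
  by rewrite (inj_eq perm_inj) neq_lift.
have f_inj : injective f.
  by move=> k l /(congr1 (lift (s i))); rewrite !fE => /perm_inj/lift_inj.
exists (perm f_inj); apply/permP => k.
case: (unliftP i k) => [j|] ->; last by rewrite lift_perm_id.
by rewrite lift_perm_lift permE fE.
Qed.

Lemma lift_perm_inj n i j : injective (@lift_perm n i j).
Proof.
move=> s t st; apply/permP => k; apply: (@lift_inj _ j).
by rewrite -!(lift_perm_lift i) st.
Qed.

Section PfaffianExpansion.
Variables (R : comNzRingType) (m : nat).
Hypothesis even_m : ~~ odd m.

(** A normalized listing of a matching starts with 0 and its partner; p.1
    encodes the partner and p.2 lists the remaining matching, so that [add_pair]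
    is a bijection onto the normalized listings. *)
Definition add_pair (p : 'I_m.+1 * 'S_m) : 'S_m.+2 :=
  lift_perm ord0 ord0 (lift_perm ord0 p.1 p.2).

Lemma add_pair0 p : add_pair p ord0 = ord0.
Proof. exact: lift_perm_id. Qed.

Lemma add_pair1 p : add_pair p (lift ord0 ord0) = lift ord0 p.1.
Proof. by rewrite lift_perm_lift lift_perm_id. Qed.

Lemma add_pair2 p i :
  add_pair p (lift ord0 (lift ord0 i)) = lift ord0 (lift p.1 (p.2 i)).
Proof. by rewrite !lift_perm_lift. Qed.

Lemma ordS_lift2 (i : 'I_m) : ~~ odd i ->
  ordS (lift ord0 (lift ord0 i)) = lift ord0 (lift ord0 (ordS i)).
Proof.
move=> oi; apply: val_inj; rewrite /= /bump /= !add1n.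
have lt_im : (i.+1 < m)%N by have := ltn_ord i; move: oi even_m; lia.
by rewrite !modn_small // ltnW.
Qed.

Lemma add_pair_inj : injective add_pair.
Proof.
move=> [j s] [k t] /lift_perm_inj eq_st.
have eq_jk : j = k by have /permP/(_ ord0) := eq_st; rewrite !lift_perm_id.
by move: eq_st; rewrite /= eq_jk => /lift_perm_inj ->.
Qed.

Lemma lift_lt n (h : 'I_n.+1) (i j : 'I_n) :
  ((lift h i < lift h j) = (i < j))%N.
Proof. by rewrite /= !ltnNge leq_bump2. Qed.

Lemma odd_lift2 (i : 'I_m) : odd (lift ord0 (lift ord0 i)) = odd i.
Proof. by rewrite /= negbK. Qed.

Lemma matching_add_pair p : matching_perm (add_pair p) = matching_perm p.2.
Proof.
apply/matching_permP/matching_permP => -[h1 h2]; split=> [i oi|i j oi oj ij].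
- have := h1 (lift ord0 (lift ord0 i)); rewrite ordS_lift2 // !add_pair2.
  by rewrite !lift_lt odd_lift2; apply.
- have := h2 (lift ord0 (lift ord0 i)) (lift ord0 (lift ord0 j)).
  by rewrite !add_pair2 !lift_lt !odd_lift2; apply.
- move: oi; case: (unliftP ord0 i) => [k|] -> oi; last first.
    suff -> : ordS ord0 = lift ord0 ord0 :> 'I_m.+2 by rewrite add_pair0 add_pair1.
    by apply: val_inj; rewrite /= modn_small.
  move: oi; case: (unliftP ord0 k) => [l|] -> // oi.
  have ol : ~~ odd l by rewrite odd_lift2 in oi.
  by rewrite ordS_lift2 // !add_pair2 !lift_lt h1.
move: oi oj ij; case: (unliftP ord0 j) => [k|] -> oi // .
move: oi; case: (unliftP ord0 k) => [l|] -> // oi ol.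
have {}ol : ~~ odd l by rewrite odd_lift2 in ol.
move: oi; case: (unliftP ord0 i) => [a|] -> oi; last by rewrite add_pair0 add_pair2.
move: oi; case: (unliftP ord0 a) => [b|] -> // oi.
have {}oi : ~~ odd b by rewrite odd_lift2 in oi.
by rewrite !add_pair2 !lift_lt; apply: h2.
Qed.

(** The index 0 must be the smaller end of its pair, and the smaller ends
    increase. *)
Lemma matching_perm_fix0 (s : 'S_m.+2) : matching_perm s -> s ord0 = ord0.
Proof.
case/matching_permP=> h1 h2; pose i := (s^-1)%g ord0.
have si : s i = ord0 by rewrite permKV.
have [i0|i_gt0] := posnP i.
  by rewrite -[RHS]si; congr (s _); apply: val_inj.
have [oi|oi] := boolP (odd i); last by have := h2 ord0 i isT oi i_gt0; rewrite si.
have lt_i : (i.-1 < m.+2)%N by rewrite (leq_ltn_trans (leq_pred _)).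
have ev_i : ~~ odd i.-1 by case: (val i) oi i_gt0.
have := h1 (Ordinal lt_i) ev_i; suff -> : ordS (Ordinal lt_i) = i by rewrite si.
by apply: val_inj; rewrite /= prednK // modn_small.
Qed.

Lemma matching_perm_add_pair (s : 'S_m.+2) :
  matching_perm s -> exists p, s = add_pair p.
Proof.
move=> /matching_perm_fix0 s0; have [s1 s1E] := lift_perm_surj ord0 s.
have [s2 s2E] := lift_perm_surj ord0 s1.
by exists (s1 ord0, s2); rewrite s1E s0 s2E /add_pair /= lift_perm_id.
Qed.

Lemma Pfaffian_expand (A : 'M[R]_m.+2) :
  Pfaffian A = \sum_(j < m.+1) (-1) ^+ j * (A ord0 (lift ord0 j) *
    Pfaffian (mxsub (lift ord0 \o lift j) (lift ord0 \o lift j) A)).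
Proof.
rewrite /Pfaffian; under [RHS]eq_bigr do rewrite 2!mulr_sumr.
rewrite pair_big_dep /=.
have -> : \sum_(s : 'S_m.+2 | matching_perm s)
     (-1) ^+ s * \prod_(i < m.+2 | ~~ odd i) A (s i) (s (ordS i)) =
   \sum_(s in add_pair @: [set p | matching_perm p.2])
     (-1) ^+ s * \prod_(i < m.+2 | ~~ odd i) A (s i) (s (ordS i)).
  apply: eq_bigl => s; apply/idP/imsetP => [sP|[p]].
    have [p sE] := matching_perm_add_pair sP; exists p => //.
    by rewrite inE -matching_add_pair -sE.
  by rewrite inE => pP ->; rewrite matching_add_pair.
rewrite big_imset /=; last by move=> p q _ _; apply: add_pair_inj.
apply: eq_big => [p|p _]; first by rewrite inE.
rewrite !odd_lift_perm /= signr_addb signr_odd -mulrA; congr (_ * _).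
rewrite mulrCA; congr (_ * _).
rewrite [LHS]big_mkcond big_ord_recl big_ord_recl /= mul1r.
rewrite [X in A _ X](_ : _ = lift ord0 p.1); last first.
  rewrite -add_pair1; congr (add_pair p _).
  by apply: val_inj; rewrite /= modn_small.
rewrite add_pair0; congr (_ * _); rewrite [RHS]big_mkcond; apply: eq_bigr => i _.
rewrite /= ?negbK. case: ifP => // oi.
by rewrite !mxE /= ordS_lift2 // !add_pair2.
Qed.

End PfaffianExpansion.

Lemma pfaff_map (R : comNzRingType) (I J : eqType) (f : I -> J)
    (A : J -> J -> R) (B : I -> I -> R) s :
  (forall a b, A (f a) (f b) = B a b) -> pfaff A (map f s) = pfaff B s.
Proof.
move=> AB; rewrite /pfaff size_map; move: (size s) => n.
elim: n s => [|k IHk] [|a s] //=; move: IHk.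
move: (pfaff_rec A k) (pfaff_rec B k) => g h.
elim: s g h => //= b s IHs g h gh; rewrite AB gh.
by rewrite (IHs _ (fun t => h (b :: t))) // => t; apply: (gh (b :: t)).
Qed.

Lemma enum_lift n (j : 'I_n.+1) :
  map (lift j) (enum 'I_n) = take j (enum 'I_n.+1) ++ drop j.+1 (enum 'I_n.+1).
Proof.
apply: (inj_map val_inj); rewrite map_cat map_take map_drop !val_enum_ord -map_comp.
rewrite (eq_map (_ : _ =1 bump j \o val)) // map_comp val_enum_ord.
rewrite take_iota drop_iota add0n; have /minn_idPl -> : (j <= n.+1)%N by rewrite ltnW.
rewrite subSS /=; move: (nat_of_ord j) (ltn_ord j) => k; rewrite ltnS => le_kn.
rewrite -{1}(subnKC le_kn).
rewrite iotaD map_cat; congr (_ ++ _).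
  rewrite -[RHS]map_id; apply/eq_in_map => i; rewrite mem_iota add0n /bump => /andP[_].
  by rewrite ltnNge => /negbTE->.
rewrite -[(k.+1)]add1n add0n [in RHS]iotaDl; apply/eq_in_map => i; rewrite mem_iota /bump.
by case/andP=> ->.
Qed.

(** The parity hypothesis keeps [ordS] from wrapping around inside the matchings
    that occur in the expansion. *)
Lemma Pfaffian_pfaff (R : comNzRingType) m (A : 'M[R]_m) : ~~ odd m ->
  Pfaffian A = pfaff A (enum 'I_m).
Proof.
elim/ltn_ind: m A => -[|[|m]] IHm A //.
  have s1 (s : 'S_0) : matching_perm s = (s == 1%g).
    have -> : s = 1%g by apply/permP => -[].
    by rewrite eqxx; apply/matching_permP; split=> -[].
  by rewrite /Pfaffian (big_pred1 1%g s1) odd_perm1 mul1r big_ord0 enum_ord0 /pfaff.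
rewrite /= negbK => even_m; rewrite Pfaffian_expand // enum_ordSl pfaff_cons.
rewrite (expandE _ _ _ _ ord0) size_map size_enum_ord; apply: eq_bigr => j _.
rewrite (nth_map ord0) ?size_enum_ord // nth_ord_enum.
rewrite IHm // -map_take -map_drop -map_cat -enum_lift -map_comp.
by congr (_ * (_ * _)); apply/esym/pfaff_map => a b; rewrite mxE.
Qed.


(** * Cofactor identities for skew matrices *)

Section SkewCofactors.
Variables (R : comNzRingType) (n : nat) (T : 'M[R]_n).
Hypotheses (T0 : forall i, T i i = 0) (TN : forall i j, T j i = - T i j).

Lemma pfaff_rem i s : i \in s -> uniq s ->
  pfaff T (i :: rem i s) = (-1) ^+ index i s * pfaff T s.
Proof.
case/splitPr=> u v; rewrite uniq_catC /= mem_cat => /andP[].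
rewrite negb_or => /andP[iv iu] _.
rewrite remE index_cat (negbTE iu) /= eqxx addn0 take_size_cat //.
by rewrite drop_cat ltnNge leqnSn subSnn /= drop0 (pfaff_move T0 TN).
Qed.

Lemma sum_cofactor_mul s (w : 'cV[R]_n) : uniq s ->
  \sum_c pfaff_cofactor T s c * (T *m w) c 0 = - \sum_k pfaff T (k :: s) * w k 0.
Proof.
move=> us; rewrite -sumrN; under eq_bigr do rewrite mxE mulr_sumr.
rewrite exchange_big /=; apply: eq_bigr => k _.
rewrite -(sum_cofactor T _ us) mulr_suml -sumrN; apply: eq_bigr => c _.
by rewrite (TN k c); ring.
Qed.

(** Alien cofactors cancel, so a vector w supported on s can be recovered from
    T w up to the factor pf(s). *)
Lemma sum_cofactor_rem_mul s i (w : 'cV[R]_n) :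
    uniq s -> i \in s -> (forall k, k \notin s -> w k 0 = 0) ->
  \sum_c pfaff_cofactor T (rem i s) c * (T *m w) c 0
    = (-1) ^+ (index i s).+1 * (pfaff T s * w i 0).
Proof.
move=> us si w0; rewrite sum_cofactor_mul ?rem_uniq // (bigD1 i) //= big1.
  by rewrite pfaff_rem // exprS; ring.
move=> k ki; have [sk|/w0->] := boolP (k \in s); last by rewrite mulr0.
by rewrite pfaff_dup ?mul0r // mem_rem_uniq // inE ki.
Qed.

(** The Pfaffian adjoint of T, which plays the role of the adjugate matrix. *)
Definition pfaff_adj : 'M[R]_n :=
  \matrix_(i, c) ((-1) ^+ i.+1 * pfaff_cofactor T (rem i (enum 'I_n)) c).

Lemma mul_pfaff_adj : pfaff_adj *m T = (pfaff T (enum 'I_n))%:M.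
Proof.
apply/matrixP=> i k; have := @sum_cofactor_rem_mul (enum 'I_n) i (delta_mx k 0).
rewrite enum_uniq mem_enum => /(_ isT isT) H.
rewrite !mxE; have {}H := H _; rewrite -[RHS](signrMK i.+1).
have -> : pfaff T (enum 'I_n) *+ (i == k) =
     pfaff T (enum 'I_n) * (delta_mx k 0 : 'cV[R]_n) i 0.
  by rewrite mxE eqxx andbT; case: (i == k); rewrite ?mulr1 ?mulr0.
rewrite index_enum_ord in H; rewrite -H => [|c]; last by rewrite mem_enum.
rewrite mulr_sumr; apply: eq_bigr => c _; rewrite !mxE mulrA; congr (_ * _).
rewrite (bigD1 k) //= big1 ?addr0 ?mxE ?eqxx ?mulr1 // => j jk.
by rewrite mxE (negbTE jk) mulr0.
Qed.

End SkewCofactors.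

Lemma map_enum_val (T : finType) (S : {set T}) :
  map (@enum_val _ (mem S)) (enum 'I_#|S|) = enum S.
Proof.
have [-> | [x xS]] := set_0Vmem S.
  by rewrite enum_set0; apply: size0nil; rewrite size_map -cardE card_ord cards0.
apply: (@eq_from_nth _ x) => [|i]; first by rewrite size_map -!cardE card_ord.
rewrite size_map -cardE card_ord => lt_i; rewrite (nth_map (Ordinal lt_i)).
  by rewrite (enum_val_nth x) nth_enum_ord.
by rewrite -cardE card_ord.
Qed.

Lemma index_filter (T : eqType) (p : pred T) x s : p x -> x \in s ->
  index x (filter p s) = count p (take (index x s) s).
Proof.
move=> px; elim: s => //= y s IHs; rewrite inE eq_sym.
have [->|yx] := eqVneq y x; first by rewrite px /= eqxx.
by case: ifP => py /IHs /= ->; rewrite ?(negbTE yx) //= py.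
Qed.

(** Like [pfbar], with 1-based labels in l: the ordered index set of the
    submatrix that remains. *)
Definition keep n (l : seq nat) : seq 'I_n :=
  [seq i : 'I_n <- enum 'I_n | i.+1 \notin l].

Section Keep.
Variable n : nat.
Implicit Types (l : seq nat) (c i : 'I_n).

Lemma keep_uniq l : uniq (keep n l).
Proof. by rewrite filter_uniq // enum_uniq. Qed.

Lemma mem_keep l i : (i \in keep n l) = (i.+1 \notin l).
Proof. by rewrite mem_filter mem_enum andbT. Qed.

Lemma rem_keep l l' i : (i.+1 :: l) =i l' -> rem i (keep n l) = keep n l'.
Proof.
move=> ll'; rewrite rem_filter ?keep_uniq // -filter_predI.
by apply: eq_filter => j; rewrite /= -ll' inE eqSS negb_or.
Qed.

Lemma index_keep l c : c.+1 \notin l ->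
  index c (keep n l) = count (fun j => j.+1 \notin l) (iota 0 c).
Proof.
move=> cl; rewrite index_filter ?mem_enum // index_enum_ord.
rewrite -(count_map val (fun j => j.+1 \notin l)) map_take val_enum_ord take_iota.
by have /minn_idPl -> := ltnW (ltn_ord c).
Qed.

Lemma pfbarE l : ~~ odd #|[set i : 'I_n | i.+1 \notin l]| ->
  pfbar n l = pfaff (genskew n) (keep n l).
Proof.
move=> even_l; rewrite /pfbar Pfaffian_pfaff //; set S := [set i | _] in even_l *.
rewrite -(@pfaff_map _ _ _ (@enum_val _ (mem S)) (genskew n)); last first.
  by move=> a b; rewrite [RHS]mxE.
suff -> : keep n l = enum S by rewrite map_enum_val.
by rewrite /keep {1}enumT; apply: eq_filter => i; rewrite -[RHS]/(i \in S) inE.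
Qed.

End Keep.

Lemma genskew0 n i : genskew n i i = 0.
Proof. by rewrite mxE ltnn. Qed.

Lemma genskewN n i j : genskew n j i = - genskew n i j.
Proof.
by rewrite !mxE; case: (ltngtP i j); rewrite ?opprK ?oppr0.
Qed.


(** * The rows of partial2 are cofactor rows *)

Section PartialTwo.
Variable n : nat.
Hypotheses (n_ge6 : (6 <= n)%N) (even_n : ~~ odd n).
Local Notation T := (genskew n).
Local Notation pf l := (pfaff (genskew n) (keep n l%N)).

Lemma size_keep l : uniq l -> all (fun x => 0 < x <= n)%N l ->
  size (keep n l) = (n - size l)%N.
Proof.
elim: l => [|[|c] l IHl] //=.
  by move=> _ _; rewrite size_filter count_predT size_enum_ord subn0.
case/andP=> cl ul /andP[lt_cn al].
rewrite -(@rem_keep _ l _ (Ordinal lt_cn)) // size_rem ?mem_keep //.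
by rewrite IHl // subnS.
Qed.

Lemma pfbar_pfaff l : uniq l -> all (fun x => 0 < x <= n)%N l ->
  ~~ odd (size l) -> pfbar n l = pf l.
Proof.
move=> ul al el; apply: pfbarE; have := size_keep ul al.
rewrite cardE; suff -> : keep n l = enum [set i : 'I_n | i.+1 \notin l].
  move=> ->; have [le_ln|/ltnW] := leqP (size l) n.
    by rewrite oddB // (negbTE el) (negbTE even_n).
  by rewrite -subn_eq0 => /eqP->.
by rewrite /keep {1}enumT; apply: eq_filter => i; rewrite -[RHS]/(i \in _) inE.
Qed.

Lemma Pfaffian_genskew : Pfaffian T = pf [::].
Proof. by rewrite Pfaffian_pfaff // /keep filter_predT. Qed.

Lemma pfaff_cofactor_keep l l' (c : 'I_n) : c.+1 \notin l -> c.+1 :: l =i l' ->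
  pfaff_cofactor T (keep n l) c =
  (-1) ^+ count (fun j => j.+1 \notin l) (iota 0 c) * pf l'.
Proof.
by move=> cl ll'; rewrite /pfaff_cofactor mem_keep cl index_keep // (rem_keep ll').
Qed.

Lemma pfaff_cofactor_keep0 l (c : 'I_n) : c.+1 \in l -> pfaff_cofactor T (keep n l) c = 0.
Proof. by move=> cl; rewrite /pfaff_cofactor mem_keep cl. Qed.

(** The 1-based indices missing from the index set whose cofactors make up row r
    of [partial2]. *)
Definition row_removed (r : nat) : seq nat :=
  nth [::] [:: [:: 1; 2; 3]; [:: 3]; [:: 2]; [:: 1]]%N r.

(** Only indices up to 3 are removed, so beyond them positions in [keep] differ
    from indices by a constant; this produces the alternating signs. *)
Lemma count_keep l k : all (leq^~ 3) l ->
  count (fun j => j.+1 \notin l) (iota 0 k.+3) =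
  (count (fun j => j.+1 \notin l) (iota 0 3) + k)%N.
Proof.
move=> l3; rewrite -addn3 addnC iotaD count_cat; congr (_ + _)%N.
rewrite -[RHS](size_iota 3); apply/eqP; rewrite -all_count.
apply/allP => j; rewrite mem_iota => /andP[j3 _]; apply/negP => /(allP l3) /=.
by rewrite ltnNge j3.
Qed.

Lemma partial2E (r : 'I_4) (c : 'I_n) :
  partial2 n r c = (-1) ^+ r.+1 * pfaff_cofactor T (keep n (row_removed r)) c.
Proof.
rewrite mxE /partial2_entry; have lt_cn := ltn_ord c.
have [n1 n2 n3] : [/\ 0 < n, 1 < n & 2 < n]%N by split; lia.
have cof l l' : c.+1 \notin l -> c.+1 :: l =i l' -> uniq l' ->
    all (fun x => 0 < x <= n)%N l' -> ~~ odd (size l') ->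
  pfaff_cofactor T (keep n l) c =
  (-1) ^+ count (fun j => j.+1 \notin l) (iota 0 c) * pfbar n l'.
  by move=> cl ll' *; rewrite pfbar_pfaff // (pfaff_cofactor_keep cl ll').
move: (pfbar n) cof => pfb cof.
have [c3|c3] := leqP 3 c; last first.
  have perm12 x y : [:: x; y] =i [:: y; x] by move=> j; rewrite !inE orbC.
  case: c c3 lt_cn cof => -[|[|[|//]]] c_n _ _ cof; case: r => -[|[|[|[|//]]]] r4 /=.
  - by rewrite pfaff_cofactor_keep0 ?mulr0.
  - by rewrite (cof _ [:: 1; 3]%N) //= ?n1 ?n2 ?n3 //; first [exact: perm12 | ring].
  - by rewrite (cof _ [:: 1; 2]%N) //= ?n1 ?n2 ?n3 //; first [exact: perm12 | ring].
  - by rewrite pfaff_cofactor_keep0 ?mulr0.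
  - by rewrite pfaff_cofactor_keep0 ?mulr0.
  - by rewrite (cof _ [:: 2; 3]%N) //= ?n1 ?n2 ?n3 //; first [exact: perm12 | ring].
  - by rewrite pfaff_cofactor_keep0 ?mulr0.
  - by rewrite (cof _ [:: 1; 2]%N) //= ?n1 ?n2 ?n3 //; first [exact: perm12 | ring].
  - by rewrite pfaff_cofactor_keep0 ?mulr0.
  - by rewrite pfaff_cofactor_keep0 ?mulr0.
  - by rewrite (cof _ [:: 2; 3]%N) //= ?n1 ?n2 ?n3 //; first [exact: perm12 | ring].
  - by rewrite (cof _ [:: 1; 3]%N) //= ?n1 ?n2 ?n3 //; first [exact: perm12 | ring].
have [k ck] : {k | c = k.+3 :> nat} by exists (c - 3)%N; lia.
have cof3 l : all (leq^~ 3) l -> uniq l -> all (leq 1) l -> odd (size l) ->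
  pfaff_cofactor T (keep n l) c =
  (-1) ^+ (count (fun j => j.+1 \notin l) (iota 0 3) + k) * pfb (rcons l c.+1).
  move=> l3 ul l1 ol; have cl : c.+1 \notin l.
    by apply/negP => /(allP l3) /=; rewrite ltnNge c3.
  rewrite (cof _ (rcons l c.+1)) //.
  - by congr (_ ^+ _ * _); rewrite ck; apply: count_keep.
  - by move=> j; rewrite mem_rcons.
  - by rewrite rcons_uniq cl.
  - rewrite all_rcons lt_cn; apply/allP => x xl.
    by rewrite (allP l1 _ xl) (leq_trans (allP l3 _ xl)).
  - by rewrite size_rcons /= ol.
by case: r => -[|[|[|[|//]]]] r4 /=; rewrite cof3 //= ck !exprS; ring.
Qed.
End PartialTwo.


(** * Ideals generated by sequences *)

Section IdealGenTheory.
Variable R : comNzRingType.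
Implicit Types (s : seq R) (I : ideal R).

Lemma ideal_mulr I x a : x \in I -> x * a \in I.
Proof. by rewrite mulrC; apply: absorbM. Qed.

Lemma mem_ideal_gen s x : x \in s -> x \in ideal_gen s.
Proof.
move=> xs; have lt_i : (index x s < size s)%N by rewrite index_mem.
apply/ideal_genP; exists (fun i => (i == Ordinal lt_i)%:R).
rewrite (bigD1 (Ordinal lt_i)) //= eqxx mul1r nth_index // big1 ?addr0 // => i.
by move/negbTE->; rewrite mul0r.
Qed.

Lemma ideal_gen_sub s I : {subset s <= I} -> {subset ideal_gen s <= I}.
Proof.
move=> sI x /ideal_genP[c ->]; apply: rpred_sum => i _.
by apply/absorbM/sI/mem_nth.
Qed.

Lemma ideal_gen_nil x : (x \in ideal_gen [::]) = (x == 0 :> R).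
Proof.
apply/ideal_genP/eqP => [[c ->]|->]; first by rewrite big_ord0.
by exists (fun=> 0); rewrite big_ord0.
Qed.

(** Adjoining one generator amounts to allowing one more multiple, which makes
    inductions along a regular sequence possible. *)
Lemma ideal_gen_rcons s a x :
  x \in ideal_gen (rcons s a) <-> exists u, x - u * a \in ideal_gen s.
Proof.
split=> [/ideal_genP[c ->]|[u xu]].
  have sz : (size s).+1 = size (rcons s a) by rewrite size_rcons.
  exists (c (cast_ord sz ord_max)); apply/ideal_genP.
  exists (fun i => c (cast_ord sz (widen_ord (leqnSn _) i))).
  rewrite (reindex (cast_ord sz)) /=; last first.
    apply: onW_bij; exists (cast_ord (esym sz)); first exact: cast_ordK.
    exact: cast_ordKV.
  rewrite big_ord_recr /=.
  rewrite nth_rcons ltnn eqxx addrK; apply: eq_bigr => i _.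
  by rewrite nth_rcons ltn_ord.
rewrite -(subrK (u * a) x); apply: rpredD; last first.
  by apply/absorbM/mem_ideal_gen; rewrite mem_rcons mem_head.
apply: ideal_gen_sub xu => y ys; apply: mem_ideal_gen.
by rewrite mem_rcons inE ys orbT.
Qed.

Lemma ideal_gen1 (a x : R) : x \in ideal_gen [:: a] <-> exists u, x = u * a.
Proof.
split=> [/(ideal_gen_rcons [::])[u]|[u ->]].
  by rewrite ideal_gen_nil subr_eq0 => /eqP; exists u.
by apply/absorbM/mem_ideal_gen/mem_head.
Qed.

Lemma ideal_gen2 (a b x : R) :
  x \in ideal_gen [:: a; b] <-> exists u v, x = u * a + v * b.
Proof.
split=> [/(ideal_gen_rcons [:: a])[v /ideal_gen1[u xE]]|[u [v ->]]].
  by exists u, v; rewrite -xE subrK.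
by apply: rpredD; apply/absorbM/mem_ideal_gen; rewrite !inE eqxx ?orbT.
Qed.

End IdealGenTheory.

(** * The product of partial2 and the generic skew matrix *)

Section PartialTwoGenskew.
Variable n : nat.
Hypotheses (n_ge6 : (6 <= n)%N) (even_n : ~~ odd n).
Local Notation R := (genring n).
Local Notation T := (genskew n).
Local Notation pf l := (pfaff (genskew n) (keep n l%N)).
Local Notation d := (fun j : 'I_4 => partial1 n 0 j).

Lemma partial1E (j : 'I_4) :
  partial1 n 0 j = pf (nth [::] [:: [::]; [:: 1; 2]; [:: 1; 3]; [:: 2; 3]] j).
Proof.
have [n1 n2 n3] : [/\ 0 < n, 1 < n & 2 < n]%N by split; lia.
rewrite mxE; case: j => -[|[|[|[|//]]]] j4 /=;
  by rewrite ?Pfaffian_genskew ?pfbar_pfaff //= ?n1 ?n2 ?n3.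
Qed.

Lemma pfaff_cons_keep l l' (k : 'I_n) : k.+1 \notin l' -> k.+1 :: l' =i l ->
  pfaff T (k :: keep n l) =
  (-1) ^+ count (fun j => j.+1 \notin l') (iota 0 k) * pf l'.
Proof.
move=> kl' l'l; rewrite -(rem_keep l'l) (pfaff_rem (@genskew0 n) (@genskewN n)).
- by rewrite index_keep.
- by rewrite mem_keep.
exact: keep_uniq.
Qed.

Lemma pfaff_cons_keep0 l (k : 'I_n) : k.+1 \notin l ->
  pfaff T (k :: keep n l) = 0.
Proof.
by move=> kl; rewrite (pfaff_dup (@genskew0 n) (@genskewN n)) // mem_keep.
Qed.

(** T is skew, so row r times column k is minus the expansion of the Pfaffian
    with k put in front of the index set of row r. *)
Lemma partial2_genskewE r k :
  (partial2 n *m T) r k = (-1) ^+ r * pfaff T (k :: keep n (row_removed r)).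
Proof.
rewrite mxE -(sum_cofactor T _ (keep_uniq n _)) mulr_sumr.
apply: eq_bigr => c _; rewrite (partial2E n_ge6 even_n) (genskewN k c) exprS.
by ring.
Qed.

(** For k beyond the third index, k already occurs in all four index sets. *)
Lemma partial2_genskew0 (k : 'I_n) : (3 <= k)%N -> col k (partial2 n *m T) = 0.
Proof.
move=> k3; apply/colP => r; rewrite mxE partial2_genskewE mxE.
rewrite pfaff_cons_keep0 ?mulr0 //.
by case: r => -[|[|[|[|//]]]] r4 /=; rewrite !inE; lia.
Qed.

(** The first three columns of the product are the Koszul relations between the
    first entry of [partial1] and the other three. *)
Lemma partial2_genskew (k : 'I_n) (j : 'I_4) : (k + j = 3)%N -> (0 < j)%N ->
  col k (partial2 n *m T) = d j *: delta_mx 0 0 - d 0 *: delta_mx j 0.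
Proof.
move=> kj j0; apply/colP => r; rewrite mxE partial2_genskewE !partial1E !mxE !eqxx !andbT.
have k3 : (k < 3)%N by lia.
case: k k3 kj => -[|[|[|//]]] k_n _ kj; case: j kj j0 => -[|[|[|[|//]]]] j4 //= _ _;
case: r => -[|[|[|[|//]]]] r4; rewrite -!val_eqE /row_removed /=;
rewrite ?mulr0 ?mulr1 ?subr0 ?sub0r ?oppr0;
first [ by rewrite pfaff_cons_keep0 ?mulr0
      | by rewrite (@pfaff_cons_keep _ [::]) //= !exprS; ring
      | by rewrite (@pfaff_cons_keep _ [:: 1; 2]%N) //= ?expr0 ?mul1r // => x; rewrite !inE; lia
      | by rewrite (@pfaff_cons_keep _ [:: 1; 3]%N) //= ?expr0 ?mul1r // => x; rewrite !inE; lia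
      | by rewrite (@pfaff_cons_keep _ [:: 2; 3]%N) //= ?expr0 ?mul1r // => x; rewrite !inE; lia].
Qed.

End PartialTwoGenskew.


(** * Consequences of the adjoint identity *)

Lemma scaled_inv_inj (R : idomainType) n m (T P : 'M[R]_n) a (A : 'M_(n, m)) :
  a != 0 -> P *m T = a%:M -> T *m A = 0 -> A = 0.
Proof.
move=> a0 PT TA; apply: (scalemx_inj a0).
by rewrite -mul_scalar_mx -PT -mulmxA TA mulmx0 scaler0.
Qed.

(** Transposing P T = a gives the right inverse -P^T of T up to a, and the two
    one-sided inverses agree after cancelling a. *)
Lemma skew_mul_inv (R : idomainType) n (T P : 'M[R]_n) a :
  T^T = - T -> a != 0 -> P *m T = a%:M -> T *m P = a%:M.
Proof.
move=> TN a0 PT; have TQ : T *m (- P^T) = a%:M.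
  by rewrite mulmxN -mulNmx -TN -trmx_mul PT tr_scalar_mx.
suff : a *: (- P^T) = a *: P by move/(scalemx_inj a0) => <-.
by rewrite -[LHS]mul_scalar_mx -{1}PT -mulmxA TQ mul_mx_scalar.
Qed.

Lemma skew_left_kernel (R : idomainType) n m (T P : 'M[R]_n) a (A : 'M_(m, n)) :
  T^T = - T -> a != 0 -> P *m T = a%:M -> A *m T = 0 -> A = 0.
Proof.
move=> TN a0 PT AT; apply: (scalemx_inj a0); rewrite scaler0.
by rewrite -mul_mx_scalar -(skew_mul_inv TN a0 PT) mulmxA AT mul0mx.
Qed.

Lemma keep_nil n : keep n [::] = enum 'I_n.
Proof. by rewrite /keep filter_predT. Qed.

Lemma col_eq0 (R : comNzRingType) m n (A : 'M[R]_(m, n)) :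
  (forall k, col k A = 0) -> A = 0.
Proof.
by move=> A0; apply/matrixP => i k; have /colP/(_ i) := A0 k; rewrite !mxE.
Qed.

Section AdjointArguments.
Variable n : nat.
Hypotheses (n_ge6 : (6 <= n)%N) (even_n : ~~ odd n).
Local Notation R := (genring n).
Local Notation T := (genskew n).
Local Notation pf l := (pfaff (genskew n) (keep n l%N)).
Local Notation d := (fun j : 'I_4 => partial1 n 0 j).
Local Notation P := (pfaff_adj (genskew n)).
Local Notation d0 := (partial1 n 0 0).
Implicit Types (x : 'cV[R]_(n - 3)) (y : 'cV[R]_n) (z : 'cV[R]_4).

Hypothesis d0_neq0 : d0 != 0.

Lemma adj_genskew : P *m T = d0%:M.
Proof.
rewrite (mul_pfaff_adj (@genskew0 n) (@genskewN n)) (partial1E n_ge6 even_n) /=.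
by rewrite keep_nil.
Qed.

Lemma genskew_tr : T^T = - T.
Proof. by apply/matrixP=> i j; rewrite [LHS]mxE genskewN [RHS]mxE. Qed.

Lemma genskew_adj : T *m P = d0%:M.
Proof.
exact: skew_mul_inv genskew_tr d0_neq0 adj_genskew.
Qed.

Lemma genskew_inj m (A : 'M_(n, m)) : T *m A = 0 -> A = 0.
Proof.
exact: scaled_inv_inj d0_neq0 adj_genskew.
Qed.

(** The inclusion of the span of the last n - 3 basis vectors: [partial3] is the
    restriction of T to it. *)
Definition shift3_mx : 'M[R]_(n, n - 3) := colsub (@shift3 n) 1%:M.

Lemma partial3E : partial3 n = T *m shift3_mx.
Proof. by rewrite mulmx_colsub mulmx1. Qed.

Lemma shift3_mx_mul x (j : 'I_(n - 3)) : (shift3_mx *m x) (shift3 j) 0 = x j 0.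
Proof.
rewrite mxE (bigD1 j) //= big1 ?addr0 => [|i ij]; first by rewrite !mxE eqxx mul1r.
rewrite !mxE -val_eqE /= eqn_add2l val_eqE eq_sym (negbTE ij); exact: mul0r.
Qed.

Lemma shift3_mx_mul0 x (i : 'I_n) : (i < 3)%N -> (shift3_mx *m x) i 0 = 0.
Proof.
move=> i3; rewrite mxE big1 // => j _; rewrite !mxE -val_eqE /=.
by rewrite ltn_eqF ?mul0r // ltn_addr.
Qed.

Lemma shift3_mxK y : (forall i : 'I_n, (i < 3)%N -> y i 0 = 0) ->
  exists x, shift3_mx *m x = y.
Proof.
move=> y0; exists (rowsub (@shift3 n) y); apply/colP => i.
have [i3|i3] := ltnP i 3; first by rewrite shift3_mx_mul0 // y0.
have lt_j : (i - 3 < n - 3)%N by rewrite ltn_sub2r // (leq_ltn_trans i3).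
have -> : i = shift3 (Ordinal lt_j) by apply: val_inj; rewrite /= subnKC.
by rewrite shift3_mx_mul mxE.
Qed.

Lemma partial3_inj x : partial3 n *m x = 0 -> x = 0.
Proof.
rewrite partial3E -mulmxA => /genskew_inj Sx; apply/colP => j.
by rewrite -shift3_mx_mul Sx !mxE.
Qed.

Lemma partial2_partial3 : partial2 n *m partial3 n = 0.
Proof.
rewrite partial3E mulmxA mulmx_colsub mulmx1; apply/matrixP => r j.
have := partial2_genskew0 n_ge6 even_n (k := shift3 j) isT.
by move/colP/(_ r); rewrite !mxE.
Qed.

(** The product with T vanishes since the columns of partial2 T are zero or Koszul
    relations, and T can be cancelled.  The quadratic relations between Pfaffians
    that the entries express thus follow from the linear ones. *)
Lemma partial1_partial2 : partial1 n *m partial2 n = 0.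
Proof.
suff XT : partial1 n *m partial2 n *m T = 0.
  exact: skew_left_kernel genskew_tr d0_neq0 adj_genskew XT.
apply: col_eq0 => k; rewrite colE.
have -> (D : 'cV_n) : partial1 n *m partial2 n *m T *m D =
    partial1 n *m (partial2 n *m T *m D) by rewrite !mulmxA.
rewrite -colE.
have [k3|k3] := ltnP k 3; last by rewrite (partial2_genskew0 n_ge6 even_n) // mulmx0.
have j4 : (3 - k < 4)%N by rewrite ltnS leq_subr.
rewrite (partial2_genskew n_ge6 even_n (j := Ordinal j4)) /= ?subn_gt0 //.
  rewrite mulmxBr -!scalemxAr -!colE; apply/colP => a.
  by rewrite !mxE mulrC subrr.
by rewrite subnKC // ltnW.
Qed.

(** Rows 4, 3, 2 of [partial2] are minus the first three rows of P. *)
Lemma adj_rows0 y : partial2 n *m y = 0 ->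
  forall i : 'I_n, (i < 3)%N -> (P *m y) i 0 = 0.
Proof.
move=> y0 i i3; have r4 : (3 - i < 4)%N by rewrite ltnS leq_subr.
have /colP/(_ (Ordinal r4)) := y0; rewrite [RHS]mxE mxE => E.
move/(congr1 -%R): E; rewrite oppr0 -sumrN => <-; rewrite mxE; apply: eq_bigr => c _.
rewrite (partial2E n_ge6 even_n) mxE -mulNr; congr (_ * _).
have -> : keep n (row_removed (Ordinal r4)) = rem i (enum 'I_n).
  rewrite -keep_nil (@rem_keep _ [::] [:: i.+1]) //=; congr keep.
  by move: i3; case: (nat_of_ord i) => [|[|[|]]].
rewrite -mulNr /=; congr (_ * _); move: i3.
by case: (nat_of_ord i) => [|[|[|//]]] _ /=; rewrite !exprS; ring.
Qed.

End AdjointArguments.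


(** * Exactness from a regular sequence *)

Lemma koszul_homotopy (R : comNzRingType) m (p : 'rV[R]_m) (z : 'cV_m) i :
  p *m z = 0 -> p 0 i *: z =
    \sum_j z j 0 *: (p 0 i *: delta_mx j 0 - p 0 j *: delta_mx i 0).
Proof.
move=> /colP/(_ 0); rewrite !mxE => z0.
under eq_bigr do rewrite scalerBr !scalerA.
rewrite sumrB -[X in _ - X]scaler_suml.
under [X in _ - X *: _]eq_bigr do rewrite mulrC.
rewrite z0 scale0r subr0; apply/colP => k; rewrite mxE summxE (bigD1 k) //=.
rewrite !mxE !eqxx mulr1 mulrC big1 ?addr0 // => j jk.
by rewrite !mxE eq_sym (negbTE jk) mulr0.
Qed.

Section Acyclicity.
Variable n : nat.
Hypotheses (n_ge6 : (6 <= n)%N) (even_n : ~~ odd n).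
Local Notation R := (genring n).
Local Notation T := (genskew n).
Local Notation pf l := (pfaff (genskew n) (keep n l%N)).
Local Notation d := (partial1 n 0).
Local Notation P := (pfaff_adj (genskew n)).
Local Notation d0 := (partial1 n 0 0).
Local Notation d1 := (partial1 n 0 1).
Local Notation d2 := (partial1 n 0 2).
Implicit Types (x : 'cV[R]_(n - 3)) (y : 'cV[R]_n) (z : 'cV[R]_4).

(** Used with the ideals (d_0) and (d_0, d_1), where it makes [partial3] injective
    modulo the ideal as soon as pf(keep l) is regular there. *)
Lemma partial3_cancel (b : ideal R) x l j : all (leq^~ 3) l ->
    (forall i, (partial3 n *m x) i 0 \in b) -> pf l * x j 0 \in b.
Proof.
move=> l3; rewrite partial3E -mulmxA => xb.
have lP : (shift3 j).+1 \notin l.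
  by apply/negP => /(allP l3) /=; rewrite ltnNge leq_addr.
have w0 (k : 'I_n) : k \notin keep n l -> (shift3_mx n *m x) k 0 = 0.
  rewrite mem_keep negbK => /(allP l3); exact: shift3_mx_mul0.
have := sum_cofactor_rem_mul (@genskew0 n) (@genskewN n) (keep_uniq n l) _ w0.
move/(_ (shift3 j)); rewrite mem_keep lP => /(_ isT); rewrite shift3_mx_mul => E.
rewrite -(signrMK (index (shift3 j) (keep n l)).+1 (_ * _)) -E.
by apply/absorbM/rpred_sum => c _; apply: absorbM.
Qed.

Hypothesis d0_neq0 : d0 != 0.
Hypothesis reg1 :
  forall a : R, d1 * a \in ideal_gen [:: d0] -> a \in ideal_gen [:: d0].
Hypothesis reg2 :
  forall a : R, d2 * a \in ideal_gen [:: d0; d1] -> a \in ideal_gen [:: d0; d1].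

(** A cycle y satisfies d_0 y = partial3 x, and x is divisible by d_0 because d_1
    kills it modulo d_0 and is regular there. *)
Lemma exact_partial2 y : partial2 n *m y = 0 <-> exists x, partial3 n *m x = y.
Proof.
split=> [y0|[x <-]]; last by rewrite mulmxA partial2_partial3 ?mul0mx.
have [x xE] := shift3_mxK (adj_rows0 n_ge6 even_n y0).
have {}xE : partial3 n *m x = d0 *: y.
  by rewrite partial3E -mulmxA xE mulmxA genskew_adj // mul_scalar_mx.
have x_d0 j : exists u, x j 0 = u * d0.
  apply/ideal_gen1/reg1; rewrite (partial1E n_ge6 even_n).
  apply: partial3_cancel => // i; rewrite xE mxE.
  by apply/ideal_mulr/mem_ideal_gen/mem_head.
have {x_d0} [u uE] := fin_all_exists x_d0.
exists (\col_j u j); apply: (scalemx_inj d0_neq0).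
rewrite -xE scalemxAr; congr (_ *m _); apply/colP => j.
by rewrite uE [LHS]mxE [X in _ * X = _]mxE mulrC.
Qed.

Definition im2 z := exists y, partial2 n *m y = z.

Lemma im2_add z z' : im2 z -> im2 z' -> im2 (z + z').
Proof. by move=> [y <-] [y' <-]; exists (y + y'); rewrite mulmxDr. Qed.

Lemma im2_scale a z : im2 z -> im2 (a *: z).
Proof. by move=> [y <-]; exists (a *: y); rewrite scalemxAr. Qed.

Lemma im2_sum (I : finType) (F : I -> 'cV[R]_4) :
  (forall i, im2 (F i)) -> im2 (\sum_i F i).
Proof.
move=> F2; apply: (big_ind im2) => // [|z z']; last exact: im2_add.
by exists 0; rewrite mulmx0.
Qed.

Definition koszul i j : 'cV[R]_4 := d i *: delta_mx j 0 - d j *: delta_mx i 0.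

(** The relations involving index 0 come from columns of T, the others are
    columns of [partial2]. *)
Lemma im2_koszul i j : im2 (koszul i j).
Proof.
have koszulN a b : im2 (koszul a b) -> im2 (koszul b a).
  by move/(im2_scale (-1)); rewrite scaleN1r opprB.
wlog le_ij : i j / (i <= j)%N.
  by move=> H; case: (leqP i j) => [/H|/ltnW/H/koszulN]; apply.
move: le_ij; rewrite leq_eqVlt => /predU1P[/val_inj->|lt_ij].
  by exists 0; rewrite mulmx0 /koszul subrr.
have [i0|i_gt0] := posnP i.
  have {i0} -> : i = 0 by apply: val_inj.
  have lt_k : (3 - j < n)%N by lia.
  apply: koszulN; exists (col (Ordinal lt_k) T).
  rewrite colE mulmxA -colE /koszul.
  by rewrite (partial2_genskew n_ge6 even_n (j := j)) //= ?subnK //; have := ltn_ord j; lia.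
have [n1 n2 n3] : [/\ 0 < n, 1 < n & 2 < n]%N by split; lia.
have col_im (k : 'I_n) : im2 (col k (partial2 n)).
  by exists (delta_mx k 0); rewrite -colE.
have kos_col (k : 'I_n) a b : (forall r, partial2_entry n r k.+1 =
    d a * (r == b)%:R - d b * (r == a)%:R) -> im2 (koszul a b).
  move=> rE; suff -> : koszul a b = col k (partial2 n) by apply: col_im.
  apply/colP => r; rewrite [RHS]mxE [RHS]mxE rE [LHS]mxE.
  by rewrite [X in X + _]mxE [X in _ + X]mxE [X in _ + - X]mxE !mxE !eqxx !andbT.
case: i j lt_ij i_gt0 => -[|[|[|[|//]]]] i4 // [[|[|[|[|//]]]] j4] //= _ _.
- apply/koszulN/(kos_col (Ordinal n1)) => r; rewrite !mxE /partial2_entry /=.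
  by case: r => -[|[|[|[|//]]]] r4; rewrite -!val_eqE /=; ring.
- apply/(kos_col (Ordinal n2)) => r; rewrite !mxE /partial2_entry /=.
  by case: r => -[|[|[|[|//]]]] r4; rewrite -!val_eqE /=; ring.
apply/koszulN/(kos_col (Ordinal n3)) => r; rewrite !mxE /partial2_entry /=.
by case: r => -[|[|[|[|//]]]] r4; rewrite -!val_eqE /=; ring.
Qed.

Lemma annihilates_cycles z i : partial1 n *m z = 0 -> im2 (d i *: z).
Proof.
move=> z0; rewrite (koszul_homotopy i z0).
by apply: im2_sum => j; apply/im2_scale/im2_koszul.
Qed.

(** Both d_0 z and d_1 z lift to R^n, to y and y'.  The cycle d_1 y - d_0 y' equals
    partial3 x with x = d_0 u + d_1 v, so that y - partial3 v is a lift of d_0 z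
    divisible by d_0. *)
Lemma exact_partial1 z : partial1 n *m z = 0 <-> exists y, partial2 n *m y = z.
Proof.
split=> [z0|[y <-]]; last by rewrite mulmxA partial1_partial2 // mul0mx.
have [y yE] := annihilates_cycles 0 z0; have [y' y'E] := annihilates_cycles 1 z0.
have [x xE] : exists x, partial3 n *m x = d1 *: y - d0 *: y'.
  apply/exact_partial2; rewrite mulmxBr -!scalemxAr yE y'E !scalerA mulrC subrr //.
have x_d01 j : exists uv : R * R, x j 0 = uv.1 * d0 + uv.2 * d1.
  suff /ideal_gen2[u [v ->]] : x j 0 \in ideal_gen [:: d0; d1] by exists (u, v).
  apply: reg2; rewrite (partial1E n_ge6 even_n 2).
  apply: partial3_cancel => // i; rewrite xE.
  rewrite mxE [X in X + _]mxE [X in _ + X]mxE [X in _ - X]mxE; apply: rpredB.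
    by apply/ideal_mulr/mem_ideal_gen; rewrite inE mem_head orbT.
  by apply/ideal_mulr/mem_ideal_gen/mem_head.
have {x_d01} [uv uvE] := fin_all_exists x_d01.
pose u : 'cV_(n - 3) := \col_j (uv j).1; pose v : 'cV_(n - 3) := \col_j (uv j).2.
have {uvE} x_uv : x = d0 *: u + d1 *: v.
  apply/colP => j; rewrite uvE [RHS]mxE [X in _ = X + _]mxE [X in _ = _ + X]mxE.
  by rewrite [u j 0]mxE [v j 0]mxE; ring.
pose w := y - partial3 n *m v.
have d1w : d1 *: w = d0 *: (y' + partial3 n *m u).
  have d1y : d1 *: y = partial3 n *m x + d0 *: y' by rewrite xE subrK.
  rewrite scalerBr d1y x_uv mulmxDr -!scalemxAr scalerDr.
  by rewrite addrAC addrK addrC.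
have w_d0 i : exists a, w i 0 = a * d0.
  apply/ideal_gen1/reg1; move/colP/(_ i): d1w; rewrite [LHS]mxE [RHS]mxE => ->.
  by apply/ideal_mulr/mem_ideal_gen/mem_head.
have {w_d0} [a aE] := fin_all_exists w_d0.
have {aE} w_a : w = d0 *: \col_i a i.
  by apply/colP => i; rewrite aE [RHS]mxE [X in _ = _ * X]mxE mulrC.
exists (\col_i a i); apply: (scalemx_inj d0_neq0).
rewrite scalemxAr -w_a mulmxBr mulmxA partial2_partial3 // mul0mx subr0.
exact: yE.
Qed.

End Acyclicity.


(** * Weighted monomial orders and leading monomials *)

Section WeightOrder.
Import Order.TTheory.
Variables (K : idomainType) (N : nat) (wt : 'I_N -> nat).
Implicit Types (p q r f g : {mpoly K[N]}) (m k : 'X_{1..N}).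

Definition mwgt m := (\sum_i m i * wt i)%N.

Lemma mwgtD m k : mwgt (m + k)%MM = (mwgt m + mwgt k)%N.
Proof.
by rewrite -big_split; apply: eq_bigr => i _; rewrite mnmDE mulnDl.
Qed.

Lemma mwgt0 : mwgt 0%MM = 0%N.
Proof. by rewrite /mwgt big1 // => i _; rewrite mnm0E. Qed.

Lemma mwgtU i : mwgt U_(i)%MM = wt i.
Proof.
rewrite /mwgt (bigD1 i) //= mnm1E eqxx mul1n big1 ?addn0 // => j ji.
by rewrite mnm1E eq_sym (negbTE ji).
Qed.

(** The built-in order on monomials only breaks ties between equal weights; it
    makes the order total and well founded even though infinitely many monomials
    may have the same weight. *)
Definition mlt m k := (mwgt m < mwgt k)%N || (mwgt m == mwgt k) && (m < k)%O.
Definition mle m k := (m == k) || mlt m k.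

Lemma mlt_irr m : mlt m m = false.
Proof. by rewrite /mlt ltnn ltxx andbF. Qed.

Lemma mlt_trans m2 m1 m3 : mlt m1 m2 -> mlt m2 m3 -> mlt m1 m3.
Proof.
rewrite /mlt => /orP[lt12|/andP[/eqP-> lt12]] /orP[lt23|/andP[/eqP<- lt23]].
- by rewrite (ltn_trans lt12 lt23).
- by rewrite lt12.
- by rewrite lt23.
by rewrite eqxx (lt_trans lt12 lt23) orbT.
Qed.

Lemma mlt_total m k : [\/ m = k, mlt m k | mlt k m].
Proof.
rewrite /mlt; have [lt_w|lt_w|eq_w] := ltngtP (mwgt m) (mwgt k).
- by constructor 2.
- by constructor 3.
by have [lt_m|lt_m|eq_m] := ltgtP m k; [constructor 2|constructor 3|constructor 1].
Qed.

Lemma mltD2l k m1 m2 : mlt (k + m1)%MM (k + m2)%MM = mlt m1 m2.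
Proof. by rewrite /mlt !mwgtD ltn_add2l eqn_add2l ltmc_add2r. Qed.

Lemma mltD2r k m1 m2 : mlt (m1 + k)%MM (m2 + k)%MM = mlt m1 m2.
Proof. by rewrite /mlt !mwgtD ltn_add2r eqn_add2r ltmc_add2l. Qed.

Lemma mlt_mleD m1 m2 k1 k2 :
  mlt m1 m2 -> mle k1 k2 -> mlt (m1 + k1)%MM (m2 + k2)%MM.
Proof.
move=> lt_m /predU1P[->|lt_k]; first by rewrite mltD2r.
by apply: (@mlt_trans (m2 + k1)%MM); rewrite ?mltD2l ?mltD2r.
Qed.

Lemma mleD m1 m2 k1 k2 :
  mle m1 m2 -> mle k1 k2 -> mle (m1 + k1)%MM (m2 + k2)%MM.
Proof.
move=> /predU1P[->|lt_m] le_k; last by rewrite /mle mlt_mleD ?orbT.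
case/predU1P: le_k => [->|lt_k]; first by rewrite /mle eqxx.
by rewrite /mle mltD2l lt_k orbT.
Qed.

Lemma mlt_ind (P : 'X_{1..N} -> Prop) :
  (forall m, (forall k, mlt k m -> P k) -> P m) -> forall m, P m.
Proof.
move=> IH m; move: {2}(mwgt m) (erefl (mwgt m)) => w.
elim/ltn_ind: w m => w IHw; apply: (@ltmwf N) => m IHm wE; apply: IH => k /orP[lt_w|].
  by apply: (IHw (mwgt k)); rewrite // -wE.
by case/andP=> /eqP eq_w lt_km; apply: IHm; rewrite ?eq_w.
Qed.

Definition below m p := forall k, k \in msupp p -> mlt k m.
Definition atmost m p := forall k, k \in msupp p -> mle k m.
Definition is_lead p m := p@_m != 0 /\ atmost m p.

Lemma below_coef0 m p : below m p -> p@_m = 0.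
Proof.
by move=> pm; apply/eqP; rewrite mcoeff_eq0; apply/negP => /pm; rewrite mlt_irr.
Qed.

Lemma below_atmost m p : below m p -> atmost m p.
Proof. by move=> pm k /pm mk; rewrite /mle mk orbT. Qed.

Lemma atmostB m p q : atmost m p -> atmost m q -> atmost m (p - q).
Proof. by move=> pm qm k /msuppB_le; rewrite mem_cat => /orP[/pm|/qm]. Qed.

Lemma atmost_below m p : atmost m p -> p@_m = 0 -> below m p.
Proof.
move=> pm p0 k kp; have /predU1P[kE|//] := pm k kp.
by rewrite kE mcoeff_msupp p0 eqxx in kp.
Qed.

Lemma atmostM m k p q : atmost m p -> atmost k q -> atmost (m + k)%MM (p * q).
Proof.
move=> pm qk l /msuppM_le /allpairsP[[m1 m2] /= [m1p m2q ->]].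
by apply: mleD; [apply: pm|apply: qk].
Qed.

Lemma belowM m k p q : below m p -> atmost k q -> below (m + k)%MM (p * q).
Proof.
move=> pm qk l /msuppM_le /allpairsP[[m1 m2] /= [m1p m2q ->]].
by apply: mlt_mleD; [apply: pm|apply: qk].
Qed.

Lemma atmostZX c m : atmost m (c *: 'X_[m]).
Proof. by move=> k /msuppZ_le; rewrite msuppX inE => /eqP->; rewrite /mle eqxx. Qed.

Lemma lead_neq0 p m : is_lead p m -> p != 0.
Proof. by case=> pm _; apply: contraNneq pm => ->; rewrite mcoeff0. Qed.

Lemma lead_exists p : p != 0 -> exists m, is_lead p m.
Proof.
suff {p} H (s : seq 'X_{1..N}) : s != [::] ->
    exists2 m, m \in s & forall k, k \in s -> mle k m.
  by rewrite -msupp_eq0 => /H[m mp pm]; exists m; split; rewrite -?mcoeff_msupp.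
elim: s => // m [|k s] IHs _.
  by exists m; rewrite ?mem_head // => l; rewrite inE => /eqP->; rewrite /mle eqxx.
have [//|l ls sl] := IHs; have [ml|ml|ml] := mlt_total m l.
- exists l; rewrite ?(in_cons m) ?ls ?orbT // => j; rewrite in_cons => /predU1P[->|/sl//].
  by rewrite /mle ml eqxx.
- exists l; rewrite ?(in_cons m) ?ls ?orbT // => j; rewrite in_cons => /predU1P[->|/sl//].
  by rewrite /mle ml orbT.
exists m; rewrite ?mem_head // => j; rewrite in_cons => /predU1P[->|/sl].
  by rewrite /mle eqxx.
by rewrite /mle => /predU1P[->|jl]; rewrite ?ml ?(mlt_trans jl ml) orbT.
Qed.

Lemma lead_uniq p m k : is_lead p m -> is_lead p k -> m = k.
Proof.
move=> [pm mp] [pk kp]; have := kp m; have := mp k.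
rewrite !mcoeff_msupp => /(_ pk)/predU1P[-> //|lt_km] /(_ pm)/predU1P[//|lt_mk].
by have := mlt_trans lt_km lt_mk; rewrite mlt_irr.
Qed.

Lemma coefXM m k p : ('X_[m] * p)@_(m + k)%MM = p@_k.
Proof. by rewrite mulrC mcoeffMX. Qed.

Lemma lead_mul p q m k : is_lead p m -> is_lead q k -> is_lead (p * q) (m + k)%MM.
Proof.
move=> [pm mp] [qk kq]; split; last exact: atmostM.
have bel : below m (p - p@_m *: 'X_[m]).
  apply: atmost_below; first exact: atmostB mp (@atmostZX _ _).
  by rewrite mcoeffB mcoeffZ mcoeffX eqxx mulr1 subrr.
rewrite -[p in p * q](subrK (p@_m *: 'X_[m])) mulrDl mcoeffD.
rewrite (below_coef0 (belowM bel kq)) add0r -scalerAl mcoeffZ.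
by rewrite coefXM mulf_neq0.
Qed.

Lemma lead_addl p q m : is_lead p m -> below m q -> is_lead (p + q) m.
Proof.
move=> [pm mp] qm; split; first by rewrite mcoeffD (below_coef0 qm) addr0.
by move=> k /msuppD_le; rewrite mem_cat => /orP[/mp//|/(below_atmost qm)].
Qed.

Lemma lead_below p m k : is_lead p m -> mlt m k -> below k p.
Proof.
by move=> [_ mp] mk l /mp/predU1P[->//|lm]; apply: mlt_trans mk.
Qed.

Lemma lead_add p q m k : is_lead p m -> is_lead q k -> m != k ->
  is_lead (p + q) m \/ is_lead (p + q) k.
Proof.
move=> pm qk; have [-> /eqP//|lt_mk _|lt_km _] := mlt_total m k.
  by right; rewrite addrC; apply: lead_addl => //; apply: lead_below lt_mk.
by left; apply: lead_addl => //; apply: lead_below lt_km.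
Qed.

Definition mcoprime m k := [forall i, (m i == 0%N) || (k i == 0%N)].

Lemma mcoprime_dvdl m k l : mcoprime m k -> (m <= k + l)%MM -> (m <= l)%MM.
Proof.
move/forallP=> mk /mnm_lepP le_m; apply/mnm_lepP => i.
by have:= le_m i; case/orP: (mk i) => /eqP E; rewrite mnmDE E.
Qed.

Implicit Type L : seq ({mpoly K[N]} * 'X_{1..N}).

Definition unit_leads L :=
  forall x, x \in L -> is_lead x.1 x.2 /\ x.1@_x.2 \is a GRing.unit.

Definition reduced L p :=
  forall m, m \in msupp p -> forall x, x \in L -> ~~ (x.2 <= m)%MM.

Lemma reduced0 L : reduced L 0.
Proof. by move=> m; rewrite msupp0. Qed.

(** Multivariate division: subtracting multiples of the generators and setting
    aside irreducible terms lowers the leading monomial. *)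
Lemma division L (I : ideal {mpoly K[N]}) p :
    unit_leads L -> {subset unzip1 L <= I} ->
  exists2 r, p - r \in I & reduced L r.
Proof.
move=> uL LI; have [->|/lead_exists[m [_]]] := eqVneq p 0.
  by exists 0; rewrite ?subrr ?rpred0 //; apply: reduced0.
elim/mlt_ind: m p => m IHm p mp.
have IHb q : below m q -> exists2 r, q - r \in I & reduced L r.
  have [->|/lead_exists[k kq]] := eqVneq q 0.
    by exists 0; rewrite ?subrr ?rpred0 //; apply: reduced0.
  by move=> /(_ k) lt_km; apply: (IHm k); [apply: lt_km; rewrite mcoeff_msupp kq.1|exact: kq.2].
have [/hasP[[f k] /= fL le_km]|/hasPn red] := boolP (has (fun x => (x.2 <= m)%MM) L).
  have [[/= fk kf] fu] := uL _ fL.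
  pose g := (p@_m / f@_k) *: 'X_[(m - k)%MM] * f.
  have [|r pgr rL] := IHb (p - g); last first.
    exists r => //; rewrite -(subrK g p) addrAC; apply: rpredD => //.
    by apply/absorbM/LI/(map_f fst fL).
  have mE : m = (m - k + k)%MM by rewrite submK.
  apply: atmost_below.
    apply: atmostB => //; rewrite /g {1}mE; apply: atmostM kf; exact: atmostZX.
  by rewrite mcoeffB /g -scalerAl mcoeffZ {3}mE coefXM divrK // subrr.
have [|r pr rL] := IHb (p - p@_m *: 'X_[m]).
  apply: atmost_below; first exact: atmostB mp (@atmostZX _ _).
  by rewrite mcoeffB mcoeffZ mcoeffX eqxx mulr1 subrr.
exists (r + p@_m *: 'X_[m]); first by rewrite opprD addrA addrAC.
move=> l /msuppD_le; rewrite mem_cat => /orP[|/msuppZ_le]; first exact: rL.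
by rewrite msuppX inE => /eqP-> x /red.
Qed.

Definition coprime_leads L := unit_leads L /\ pairwise mcoprime (unzip2 L).

Lemma coprime_leads_rcons L x : coprime_leads (rcons L x) ->
  [/\ coprime_leads L, is_lead x.1 x.2
    & forall y, y \in L -> mcoprime y.2 x.2].
Proof.
case=> uL; rewrite /unzip2 map_rcons pairwise_rcons => /andP[/allP cx cL].
split; first by split=> // y yL; apply: uL; rewrite mem_rcons inE yL orbT.
  by case: (uL x); rewrite ?mem_rcons ?mem_head.
by move=> y yL; apply/cx/map_f.
Qed.

(** The generators form a Groebner basis.  An element is q + r f with q in the
    smaller ideal and r reduced modulo it; the leads of q and of r f cannot
    cancel, since coprimality would make the lead of r reducible. *)
Lemma lead_ideal L p m : coprime_leads L ->
    p \in ideal_gen (unzip1 L) -> is_lead p m ->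
  exists2 x, x \in L & (x.2 <= m)%MM.
Proof.
elim/last_ind: L p m => [|L [f k] IHL] p m cL.
  by rewrite ideal_gen_nil => /eqP-> /lead_neq0; rewrite eqxx.
have [cL' fk ck] := coprime_leads_rcons cL.
rewrite /unzip1 map_rcons => /ideal_gen_rcons[u pu] pm.
have [r ur rL] := division u cL'.1 (@mem_ideal_gen _ (unzip1 L)).
have [q qL pE] : exists2 q, q \in ideal_gen (unzip1 L) & p = q + r * f.
  exists (p - r * f); last by rewrite subrK.
  have -> : p - r * f = (p - u * f) + (u - r) * f by ring.
  by apply: rpredD => //; apply: ideal_mulr.
have IH q' m' : q' \in ideal_gen (unzip1 L) -> is_lead q' m' ->
    exists2 x, x \in rcons L (f, k) & (x.2 <= m')%MM.
  by move=> q'L /(IHL _ _ cL' q'L)[x xL xm']; exists x; rewrite // mem_rcons inE xL orbT.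
have [r0|/lead_exists[l lr]] := eqVneq r 0.
  by apply: (IH _ _ qL); rewrite -[q]addr0 -(mul0r f) -r0 -pE.
have fkm m' : (k <= m')%MM -> exists2 x, x \in rcons L (f, k) & (x.2 <= m')%MM.
  by exists (f, k); rewrite // mem_rcons mem_head.
have lrf : is_lead (r * f) (l + k)%MM := lead_mul lr fk.
have [q0|/lead_exists[j jq]] := eqVneq q 0.
  apply: fkm; move: pm; rewrite pE q0 add0r => /lead_uniq/(_ lrf)->.
  exact: lem_addl.
have jlk : j != (l + k)%MM.
  apply/eqP => jE; have [x xL] := IHL _ _ cL' qL jq.
  rewrite jE addmC => /(mcoprime_dvdl (ck _ xL)); apply/negP.
  by apply: rL xL; rewrite mcoeff_msupp lr.1.
case: (lead_add jq lrf jlk); rewrite -pE => /(lead_uniq pm)->.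
  exact: IH qL jq.
by apply/fkm/lem_addl.
Qed.

(** A nonzero remainder r of a would give f r in the ideal with a lead divisible
    by some earlier lead, hence, by coprimality, a reducible lead of r. *)
Lemma lead_regular L f k a : coprime_leads (rcons L (f, k)) ->
  f * a \in ideal_gen (unzip1 L) -> a \in ideal_gen (unzip1 L).
Proof.
move=> /coprime_leads_rcons[cL fk ck] faL.
have [r ar rL] := division a cL.1 (@mem_ideal_gen _ (unzip1 L)).
suff r0 : r = 0 by rewrite -[a]subr0 -r0.
apply/eqP/negP => /negP/lead_exists[m rm].
have frL : f * r \in ideal_gen (unzip1 L).
  have -> : f * r = f * a - f * (a - r) by ring.
  by apply: rpredB => //; apply: absorbM.
have [x xL] := lead_ideal cL frL (lead_mul fk rm).
move/(mcoprime_dvdl (ck _ xL)); apply/negP; apply: rL xL.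
by rewrite mcoeff_msupp rm.1.
Qed.

End WeightOrder.


(** * Leading monomials of Pfaffians *)

Definition sqdist (a b : nat) : nat := ((a - b) + (b - a)) ^ 2.

Lemma sqdistE a b : (sqdist a b)%:Z = (a%:Z - b%:Z) ^+ 2.
Proof.
rewrite /sqdist; have [ab|/ltnW ab] := leqP a b.
  by rewrite -(subnK ab); move: (b - a)%N => k; lia.
by rewrite -(subnK ab); move: (a - b)%N => k; lia.
Qed.

(** Maximizing (a - b)^2 amounts to minimizing (a + b - c)^2, up to a sum of
    vertex potentials that does not depend on the matching. *)
Lemma sqdist_parallelogram a b c :
  (2 * sqdist a b + 2 * sqdist (a + b) c =
   sqdist (2 * a) c + sqdist (2 * b) c)%N.
Proof.
have := sqdistE a b; have := sqdistE (a + b) c.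
have := sqdistE (2 * a) c; have := sqdistE (2 * b) c.
move: (sqdist a b) (sqdist _ c) (sqdist _ c) (sqdist _ c) => x y z t.
rewrite !PoszM PoszD => tE zE yE xE; apply/eqP; rewrite -eqz_nat (PoszD (2 * x)) (PoszD z) !(PoszM 2).
by rewrite xE yE zE tE; apply/eqP; ring.
Qed.

Lemma sqdist_eq0 a b : (sqdist a b == 0)%N = (a == b).
Proof. by rewrite /sqdist expn_eq0; lia. Qed.

Section Leads.
Variables (n : nat) (pos : 'I_n -> nat) (c : nat).
Local Notation R := (genring n).
Local Notation A := (fun i j => genskew n i j).
Implicit Types (p q : R) (s t u v : seq 'I_n) (a b : 'I_n).

Definition edge (e : 'I_#|{: upair n}|) : 'I_n * 'I_n := val (enum_val e).
Definition edge_wt e := sqdist (pos (edge e).1) (pos (edge e).2).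
Definition edge_sum e := (pos (edge e).1 + pos (edge e).2)%N.

Local Notation wgt := (mwgt edge_wt).

Lemma genskew_edge a b : a != b -> exists e (r : bool),
  [/\ genskew n a b = (-1) ^+ r * 'X_e, edge_wt e = sqdist (pos a) (pos b)
    & edge_sum e = (pos a + pos b)%N].
Proof.
have lt_case (i j : 'I_n) : (i < j)%N -> exists e, [/\ tau i j = 'X_e,
    edge_wt e = sqdist (pos i) (pos j) & edge_sum e = (pos i + pos j)%N].
  move=> lt_ij; have lt_p : ((i, j).1 < (i, j).2)%N by [].
  exists (enum_rank (Sub (i, j) lt_p : upair n)).
  by rewrite /tau insubT /edge_wt /edge_sum /edge enum_rankK.
rewrite -val_eqE neq_ltn => /orP[lt_ab|lt_ba].
  have [e [eE wE sE]] := lt_case a b lt_ab; exists e, false.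
  by split=> //; rewrite mxE lt_ab eE mul1r.
have [e [eE wE sE]] := lt_case b a lt_ba; exists e, true; split.
- by rewrite mxE lt_ba ltnNge (ltnW lt_ba) eE mulN1r.
- by rewrite wE /sqdist addnC.
by rewrite sE addnC.
Qed.

(** The vertex potential: twice the weight of an edge ab is at most
    psi a + psi b, with equality when pos a + pos b = c. *)
Definition psi a := sqdist (2 * pos a) c.
Definition Psi s := (\sum_(a <- s) psi a)%N.

Lemma psiE a b :
  (psi a + psi b = 2 * sqdist (pos a) (pos b) + 2 * sqdist (pos a + pos b) c)%N.
Proof. by rewrite sqdist_parallelogram. Qed.

Definition wbound B p := forall m, m \in msupp p -> (2 * wgt m < B)%N.

Lemma wbound0 B : wbound B 0.
Proof. by move=> m; rewrite msupp0. Qed.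

Lemma wboundD B p q : wbound B p -> wbound B q -> wbound B (p + q).
Proof. by move=> pB qB m /msuppD_le; rewrite mem_cat => /orP[/pB|/qB]. Qed.

Lemma wboundN B p : wbound B p -> wbound B (- p).
Proof. by move=> pB m; rewrite (perm_mem (msuppN p)); apply: pB. Qed.

Lemma wboundM B1 B2 p q :
  wbound B1.+1 p -> wbound B2 q -> wbound (B1 + B2) (p * q).
Proof.
move=> pB qB m /msuppM_le /allpairsP[[m1 m2] /= [m1p m2q ->]].
by have := pB _ m1p; have := qB _ m2q; rewrite mwgtD; lia.
Qed.

(** The part of T on the edges with midpoint c/2, on which the bound is
    attained. *)
Definition level a b : R := if (pos a + pos b == c)%N then genskew n a b else 0.

Lemma wbound_genskew a b : wbound (psi a + psi b).+1 (genskew n a b).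
Proof.
have [->|ab] := eqVneq a b; first by rewrite genskew0; apply: wbound0.
have [e [r [-> eE _]]] := genskew_edge ab.
move=> m; rewrite mulr_sign; case: r; rewrite ?(perm_mem (msuppN _)) msuppX inE;
  by move=> /eqP->; rewrite mwgtU eE psiE ltnS leq_addr.
Qed.

Lemma wbound_genskew_level a b :
  wbound (psi a + psi b) (genskew n a b - level a b).
Proof.
rewrite /level; case: eqP => [_|/eqP ne_c]; first by rewrite subrr; apply: wbound0.
have [->|ab] := eqVneq a b; first by rewrite genskew0 subrr; apply: wbound0.
have [e [r [-> eE _]]] := genskew_edge ab; rewrite subr0.
move=> m; rewrite mulr_sign; case: r; rewrite ?(perm_mem (msuppN _)) msuppX inE;
  move=> /eqP->; rewrite mwgtU eE psiE -[ltnLHS]addn0 ltn_add2l muln_gt0 /=;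
  by rewrite lt0n sqdist_eq0.
Qed.

Lemma wbound_level a b : wbound (psi a + psi b).+1 (level a b).
Proof.
rewrite /level; case: ifP => _; first exact: wbound_genskew.
exact: wbound0.
Qed.

Lemma wbound_expand a (g h : seq 'I_n -> R) s B :
    (forall t, wbound (B + Psi t).+1 (g t)) ->
    (forall t, wbound (B + Psi t) (g t - h t)) ->
  wbound (B + Psi (a :: s)).+1 (expand A a g s) /\
  wbound (B + Psi (a :: s)) (expand A a g s - expand level a h s).
Proof.
elim: s g h B => [|b s IHs] g h B gB ghB /=.
  by rewrite subrr; split; apply: wbound0.
have PsiE : (B + Psi [:: a, b & s] = psi a + psi b + (B + Psi s))%N.
  by rewrite /Psi !big_cons; lia.
have PsiE' : (B + Psi [:: a, b & s] = B + psi b + Psi (a :: s))%N.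
  by rewrite /Psi !big_cons; lia.
have [||e1 e2] := IHs (fun t => g (b :: t)) (fun t => h (b :: t)) (B + psi b)%N.
- by move=> t; have := gB (b :: t); rewrite /Psi big_cons addnA.
- by move=> t; have := ghB (b :: t); rewrite /Psi big_cons addnA.
split.
  apply: wboundD; last by apply: wboundN; rewrite PsiE'.
  by rewrite PsiE -addnS; apply: wboundM; first exact: wbound_genskew.
have -> : genskew n a b * g s - expand A a (fun t => g (b :: t)) s -
    (level a b * h s - expand level a (fun t => h (b :: t)) s) =
  level a b * (g s - h s) + (genskew n a b - level a b) * g s
  - (expand A a (fun t => g (b :: t)) s
     - expand level a (fun t => h (b :: t)) s) by ring.
apply: wboundD; last by apply: wboundN; rewrite PsiE'.
rewrite PsiE; apply: wboundD.
  by apply: wboundM; first exact: wbound_level.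
by rewrite mulrC addnC; apply: wboundM; last exact: wbound_genskew_level.
Qed.

(** Replacing T by [level] changes the Pfaffian only by terms of weight strictly
    below the maximum, as every such term has an edge off the level. *)
Lemma wbound_pfaff s : wbound (Psi s) (pfaff A s - pfaff level s).
Proof.
rewrite /pfaff; move: (size s) => k.
suff : wbound (Psi s).+1 (pfaff_rec A k s) /\
  wbound (Psi s) (pfaff_rec A k s - pfaff_rec level k s) by case.
elim: k s => [|k IHk] [|a s] /=; rewrite ?subrr;
  try by split; try exact: wbound0; move=> m;
    rewrite msupp1 inE => /eqP->; rewrite mwgt0.
by have [||] := @wbound_expand a (pfaff_rec A k) (pfaff_rec level k) s 0 => [t|t|//];
  have [] := IHk t.
Qed.

Lemma level0 a : level a a = 0.
Proof. by rewrite /level genskew0 if_same. Qed.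

Lemma levelN a b : level b a = - level a b.
Proof. by rewrite /level addnC genskewN; case: ifP; rewrite ?oppr0. Qed.

(** The sequence is symmetric about c/2: each index has exactly one partner at
    the mirror position.  Positions may coincide, which is how the index at the
    centre is given a partner distinct from itself. *)
Definition paired s := uniq s /\ forall a, a \in s -> exists b,
  [/\ b \in s, b != a
    & forall d, d \in s -> d != a -> (pos a + pos d == c)%N = (d == b)].

Lemma expand_eq0 (B : 'I_n -> 'I_n -> R) a g s :
  (forall d, d \in s -> B a d = 0) -> expand B a g s = 0.
Proof.
elim: s g => //= b s IHs g B0; rewrite B0 ?mem_head // mul0r IHs ?subr0 // => t ts.
by rewrite B0 // inE ts orbT.
Qed.

(** On a symmetric set the level edges form a single perfect matching, so only
    one term survives. *)
Lemma pfaff_level s : paired s -> exists (m : 'X_{1..#|{: upair n}|}) (r : bool),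
  [/\ pfaff level s = (-1) ^+ r * 'X_[m], (2 * wgt m = Psi s)%N
    & forall e, m e != 0%N -> edge_sum e = c].
Proof.
have [k] := ubnP (size s); elim: k s => // k IHk [|a s] lt_s [us sP].
  exists 0%MM, false; rewrite /pfaff /= mul1r mpolyX0 /Psi big_nil; split=> //.
    by rewrite mwgt0.
  by move=> e; rewrite mnm0E.
have [b [bs ba ab]] := sP a (mem_head _ _).
move: bs; rewrite inE (negbTE ba) /= => bs.
case/splitPr: bs lt_s us sP ab => u v lt_s us sP ab.
have perm_ab : perm_eq (a :: u ++ b :: v) [:: a, b & u ++ v].
  by rewrite perm_cons -[b :: v]cat1s perm_catCA.
have mem_ab := perm_mem perm_ab; rewrite (perm_uniq perm_ab) in us.
have {us} [a_uv b_uv us] : [/\ a \notin u ++ v, b \notin u ++ v & uniq (u ++ v)].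
  by case/and3P: us; rewrite inE negb_or => /andP[].
have [a' [_ _]] : exists b', [/\ b' \in a :: u ++ b :: v, b' != b & forall d,
    d \in a :: u ++ b :: v -> d != b -> (pos b + pos d == c)%N = (d == b')].
  by apply: sP; rewrite mem_ab inE mem_head orbT.
have ab_sum : (pos a + pos b == c)%N by rewrite ab ?eqxx // mem_ab inE mem_head orbT.
move=> ba'; have {a' ba'} ba' d : d \in a :: u ++ b :: v -> d != b ->
    (pos b + pos d == c)%N = (d == a).
  suff aE : a = a' by move=> ds db; rewrite ba' // -aE.
  by apply/eqP; rewrite -ba' ?mem_head ?[a == b]eq_sym ?ba // addnC.
have uv_sub d : d \in u ++ v -> [/\ d \in a :: u ++ b :: v, d != a & d != b].
  move=> duv; split; first by rewrite mem_ab !inE duv !orbT.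
    by apply: contraNneq a_uv => <-.
  by apply: contraNneq b_uv => <-.
have level_b d : d \in u ++ v -> level b d = 0.
  by case/uv_sub=> ds da db; rewrite /level ba' // (negbTE da).
have uvP : paired (u ++ v).
  split=> // d duv; have [ds da db] := uv_sub _ duv; have [e [es ed eP]] := sP _ ds.
  exists e; split=> //; last by move=> x /uv_sub[xs _ _]; apply: eP.
  move: es; rewrite mem_ab !inE => /or3P[/eqP ea|/eqP eb|//].
    have := ab _ ds da; rewrite addnC eP ?mem_head 1?eq_sym // ea eqxx => /esym.
    by rewrite (negbTE db).
  have := ba' _ ds db; rewrite addnC eP 1?eq_sym // ?eb ?eqxx => [/esym|].
    by rewrite (negbTE da).
  by rewrite mem_ab !inE eqxx orbT.
have lt_uv : (size (u ++ v) < k)%N by move: lt_s; rewrite /= !size_cat /=; lia.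
have [m [r [mE wE eE]]] := IHk _ lt_uv uvP.
have [e [r' [E wtE sumE]]] := genskew_edge ba.
exists (U_(e) + m)%MM, (odd (size (a :: u)) (+) r' (+) r); split.
- have -> : a :: u ++ b :: v = (a :: u) ++ b :: v by [].
  rewrite -[LHS](signrMK (size (a :: u))) -(pfaff_move level0 levelN) pfaff_cons /=.
  rewrite expand_eq0 // subr0 mE /level addnC ab_sum E mpolyXD.
  by rewrite -signr_odd !signr_addb; ring.
- rewrite mwgtD mulnDr wE mwgtU wtE /Psi (perm_big _ perm_ab) /= !big_cons addnA.
  congr (_ + _)%N; rewrite psiE (eqP ab_sum) [sqdist c c]/sqdist subnn addn0.
  by rewrite muln0 addn0 /sqdist [(pos b - pos a + _)%N]addnC.
move=> x; rewrite mnmDE mnm1E; have [<- _|ex] := eqVneq e x; last exact: eE.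
by rewrite sumE addnC (eqP ab_sum).
Qed.

Lemma lead_pfaff s : paired s -> exists m : 'X_{1..#|{: upair n}|},
  [/\ is_lead edge_wt (pfaff A s) m, (pfaff A s)@_m \is a GRing.unit
    & forall e, m e != 0%N -> edge_sum e = c].
Proof.
case/pfaff_level=> m [r [mE wE eE]]; exists m.
have diff : below edge_wt m (pfaff A s - pfaff level s).
  move=> k /wbound_pfaff lt_k; rewrite /mlt.
  by apply/orP; left; move: lt_k; rewrite -wE ltn_mul2l.
have coef : (pfaff level s)@_m = (-1) ^+ r.
  rewrite mE; case: r {mE}; last by rewrite !mul1r mcoeffX eqxx.
  by rewrite !mulN1r mcoeffN mcoeffX eqxx.
split=> //; rewrite -[pfaff A s](subrK (pfaff level s)).
  rewrite addrC; apply: lead_addl diff; split; first by rewrite coef signr_eq0.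
  rewrite mE mulr_sign => k; case: (r); rewrite ?(perm_mem (msuppN _)) msuppX inE;
    by rewrite /mle => ->.
by rewrite mcoeffD (below_coef0 diff) add0r coef unitrX ?unitrN1.
Qed.

End Leads.


(** * A regular sequence of length three *)

Section RegularSequence.
Variable n : nat.
Hypotheses (n_ge6 : (6 <= n)%N) (even_n : ~~ odd n).
Local Notation R := (genring n).
Local Notation pf l := (pfaff (genskew n) (keep n l%N)).
Local Notation d := (partial1 n 0).

(** The indices from 3 on form a segment, centred at n/2 + 1.  Placing 1 and 2 at
    its two outer ends and 0 at its centre makes the segment with 0 and 1 and 2,
    with 2 only, and with 1 only, symmetric about (n + 2)/2, (n + 3)/2 and
    (n + 1)/2. *)
Definition position (i : 'I_n) : nat :=
  if (i < 3)%N then nth 0%N [:: n./2.+1; 2; n]%N i else i.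

Lemma paired_keep c l : 
    (forall a : nat, (a < n)%N -> a.+1 \notin l -> exists b, 
      [/\ (b < n)%N, b.+1 \notin l, b != a &
       forall d, (d < n)%N -> d.+1 \notin l -> d != a ->
        ((if a < 3 then nth 0 [:: n./2.+1; 2; n] a else a) +
        (if d < 3 then nth 0 [:: n./2.+1; 2; n] d else d) == c)%N = (d == b)]) ->
  paired position c (keep n l).
Proof.
move=> H; split=> [|a]; first exact: keep_uniq.
rewrite mem_keep => /(H _ (ltn_ord a))[b [lt_b bl ba bP]].
exists (Ordinal lt_b); split; rewrite ?mem_keep // => e.
by rewrite mem_keep => el ea; apply: bP.
Qed.

Lemma paired_Pf : paired position (n + 2) (keep n [::]).
Proof.
have nE : n = (n./2 * 2)%N by rewrite muln2 even_halfK.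
apply: paired_keep => a lt_a _; case: a lt_a => [|[|[|a]]] lt_a /=.
(* The partner of an index has the mirror position, and the index at the centre
   n/2 + 1 of the segment is paired with 0. *)
- exists n./2.+1; split=> [|||[|[|[|e]]]] /=; lia.
- exists 2%N; split=> [|||[|[|[|e]]]] /=; lia.
- exists 1%N; split=> [|||[|[|[|e]]]] /=; lia.
have [aE|aE] := eqVneq a.+3 n./2.+1.
  exists 0%N; split=> [|||[|[|[|e]]]] /=; lia.
exists (n + 2 - a.+3)%N; split=> [|||[|[|[|e]]]] /=; lia.
Qed.

Lemma paired_pf12 : paired position (n + 3) (keep n [:: 1; 2]%N).
Proof.
have nE : n = (n./2 * 2)%N by rewrite muln2 even_halfK.
apply: paired_keep => a lt_a; case: a lt_a => [|[|[|[|a]]]] lt_a //= _.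
- exists 3%N; split=> // [|[|[|[|e]]]] //=; rewrite ?inE; lia.
- exists 2%N; split=> // [|[|[|[|e]]]] //=; rewrite ?inE; lia.
exists (n + 3 - a.+4)%N; split=> [|||[|[|[|e]]]] //=; rewrite ?inE; lia.
Qed.

Lemma paired_pf13 : paired position (n + 1) (keep n [:: 1; 3]%N).
Proof.
have nE : n = (n./2 * 2)%N by rewrite muln2 even_halfK.
apply: paired_keep => a lt_a; case: a lt_a => [|[|[|a]]] lt_a //= _.
- exists n.-1; split=> [|||[|[|[|e]]]] //=; rewrite ?inE; lia.
have [aE|aE] := eqVneq a.+3 n.-1.
  exists 1%N; split=> [|||[|[|[|e]]]] //=; rewrite ?inE; lia.
exists (n + 1 - a.+3)%N; split=> [|||[|[|[|e]]]] //=; rewrite ?inE; lia.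
Qed.

(** An edge determines the sum of the positions of its ends, so matchings with
    distinct sums involve disjoint sets of variables. *)
Lemma regular_partial1 : exists L : seq (R * 'X_{1..#|{: upair n}|}),
  unzip1 L = [:: d 0; d 1; d 2] /\ coprime_leads (edge_wt position) L.
Proof.
have [m0 [l0 u0 s0]] := lead_pfaff paired_Pf.
have [m1 [l1 u1 s1]] := lead_pfaff paired_pf12.
have [m2 [l2 u2 s2]] := lead_pfaff paired_pf13.
exists [:: (pf [::], m0); (pf [:: 1; 2], m1); (pf [:: 1; 3], m2)].
split; first by rewrite !(partial1E n_ge6 even_n).
split; first by move=> x; rewrite !inE => /or3P[]/eqP->.
have coprime_sums (k l : 'X_{1..#|{: upair n}|}) a b : a != b ->
    (forall e, k e != 0%N -> edge_sum position e = a) ->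
    (forall e, l e != 0%N -> edge_sum position e = b) -> mcoprime k l.
  move=> ab ka lb; apply/forallP => e; apply: contraR ab.
  by rewrite negb_or => /andP[/ka<- /lb<-].
rewrite /= (coprime_sums _ _ _ _ _ s0 s1) ?(coprime_sums _ _ _ _ _ s0 s2);
  by rewrite ?(coprime_sums _ _ _ _ _ s1 s2) ?eqn_add2l.
Qed.

Lemma partial1_reg0 : d 0 != 0.
Proof.
have [m0 [l0 _ _]] := lead_pfaff paired_Pf.
by rewrite (partial1E n_ge6 even_n) /=; apply: lead_neq0 l0.
Qed.

Lemma partial1_reg1 a : d 1 * a \in ideal_gen [:: d 0] -> a \in ideal_gen [:: d 0].
Proof.
have [L [LE cL]] := regular_partial1.
case: L LE cL => [|[f0 m0] [|[f1 m1] [|[f2 m2] [|//]]]] //= [<- <- _] cL.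
have [cL2 _ _] := coprime_leads_rcons (L := [:: (f0, m0); (f1, m1)]) cL.
exact: (lead_regular (L := [:: (f0, m0)])) cL2.
Qed.

Lemma partial1_reg2 a :
  d 2 * a \in ideal_gen [:: d 0; d 1] -> a \in ideal_gen [:: d 0; d 1].
Proof.
have [L [LE cL]] := regular_partial1.
case: L LE cL => [|[f0 m0] [|[f1 m1] [|[f2 m2] [|//]]]] //= [<- <- <-] cL.
exact: (lead_regular (L := [:: (f0, m0); (f1, m1)])) cL.
Qed.

End RegularSequence.


(** * Lifting maps through exact sequences *)

Section Kernel.
Variables (R : comNzRingType) (U V : lmodType R) (g : {linear U -> V}).

Definition kernel_pred : {pred U} := fun x => g x == 0.

Fact kernel_submod_closed : submod_closed kernel_pred.
Proof.
split=> [|a x y]; rewrite !unfold_in ?linear0 // => /eqP gx /eqP gy.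
by rewrite linearP gx gy scaler0 addr0.
Qed.

HB.instance Definition _ :=
  GRing.isSubmodClosed.Build R U kernel_pred kernel_submod_closed.

(** Lifting against an exact sequence needs a surjection onto a module, namely
    onto this kernel. *)
Record kernel := Kernel { kernel_val : U; _ : kernel_val \in kernel_pred }.

HB.instance Definition _ := [isSub for kernel_val].
HB.instance Definition _ := [Choice of kernel by <:].
HB.instance Definition _ := [SubChoice_isSubLmodule of kernel by <:].

End Kernel.

Section Lifting.
Variable R : comNzRingType.

Lemma projective_lift (P U V W : lmodType R) (u : {linear U -> V})
    (w : {linear V -> W}) (f : {linear P -> V}) :
    projective P -> exact_at u w -> (forall x, w (f x) = 0) ->
  exists h : {linear P -> U}, forall x, u (h x) = f x.
Proof.
move=> projP uw wf.
have uK x : u x \in kernel_pred w.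
  by rewrite unfold_in; apply/eqP/uw; exists x.
have fK x : f x \in kernel_pred w by rewrite unfold_in wf.
pose u' x := Kernel (uK x); pose f' x := Kernel (fK x).
have u'L : linear u' by move=> a x y; apply: val_inj; rewrite /= linearP.
have f'L : linear f' by move=> a x y; apply: val_inj; rewrite /= linearP.
pose u'M := GRing.isLinear.Build _ _ _ _ u' u'L.
pose u'l : {linear U -> kernel w} := HB.pack u' u'M.
pose f'M := GRing.isLinear.Build _ _ _ _ f' f'L.
pose f'l : {linear P -> kernel w} := HB.pack f' f'M.
have [|h hP] := projP _ _ u'l f'l; last first.
  by exists h => x; have /(congr1 val) := hP x.
move=> [y yK]; have /uw[x xy] : w y = 0 by apply/eqP; rewrite unfold_in in yK.
by exists x; apply: val_inj.
Qed.

Lemma free_lift m (U V : lmodType R) (u : {linear U -> V})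
    (f : {linear 'cV[R]_m -> V}) :
    (forall x, exists y, u y = f x) ->
  exists h : {linear 'cV[R]_m -> U}, forall x, u (h x) = f x.
Proof.
move=> uf; have [y yE] := fin_all_exists (fun i => uf (delta_mx i 0)).
pose h (x : 'cV[R]_m) := \sum_i x i 0 *: y i.
have hL : linear h.
  move=> a x z; rewrite /h scaler_sumr -big_split; apply: eq_bigr => i _.
  by rewrite !mxE scalerDl scalerA.
pose hM := GRing.isLinear.Build _ _ _ _ h hL.
pose hl : {linear 'cV[R]_m -> U} := HB.pack h hM.
exists hl => x; rewrite /= /h linear_sum.
have {2}-> : x = \sum_i x i 0 *: delta_mx i 0.
  by rewrite {1}[x]matrix_sum_delta; apply: eq_bigr => i _; rewrite big_ord1.
by rewrite linear_sum; apply: eq_bigr => i _; rewrite !linearZ /= yE.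
Qed.

Lemma projective_free m : projective 'cV[R]_m.
Proof. by move=> M N g f gS; apply: free_lift => x; apply: gS. Qed.

End Lifting.


(** * Free resolutions and the depth of an ideal *)

Section FreeResolution.
Variables (R : comNzRingType) (r : nat -> nat).
Variable D : forall k, 'M[R]_(r k, r k.+1).
Arguments D : clear implicits.

Hypothesis exactD : forall k (v : 'cV[R]_(r k.+1)),
  D k *m v = 0 <-> exists u, D k.+1 *m u = v.

Lemma complexD k : D k *m D k.+1 = 0.
Proof.
apply/trmx_inj/row_matrixP => j; rewrite trmx0 row0 -tr_col -[LHS]trmxK.
suff -> : col j (D k *m D k.+1) = 0 by rewrite !trmx0.
rewrite colE -mulmxA; apply/exactD; by exists (delta_mx j 0).
Qed.

Lemma exactD_mx k m (A : 'M[R]_(r k.+1, m)) :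
  D k *m A = 0 -> exists B, D k.+1 *m B = A.
Proof.
move=> DA; have [|b bE] := @fin_all_exists _ (fun=> 'cV[R]_(r k.+2))
    (fun j u => D k.+1 *m u = col j A).
  by move=> j; apply/exactD; rewrite colE mulmxA DA mul0mx.
exists (\matrix_(i, j) b j i 0); apply/matrixP => i j.
have /colP/(_ i) := bE j; rewrite !mxE => <-.
by apply: eq_bigr => l _; rewrite mxE.
Qed.

Definition null_homotopic a := exists h : forall k, 'M[R]_(r k.+1, r k),
  D 0%N *m h 0%N = a%:M /\ forall k, D k.+1 *m h k.+1 + h k *m D k = a%:M.

(** The homotopy is built degree by degree; the invariant D h D = a D is what
    makes a - h D land in the kernel of D, so that it lifts to the next degree. *)
Lemma null_homotopy a (h0 : 'M[R]_(r 1%N, r 0%N)) :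
  D 0%N *m h0 = a%:M -> null_homotopic a.
Proof.
move=> Dh0; pose ok k (h : 'M[R]_(r k.+1, r k)) := D k *m h *m D k = a *: D k.
have step k (h : {h | ok k h}) :
    {h' : {h' | ok k.+1 h'} | D k.+1 *m sval h' + sval h *m D k = a%:M}.
  case: h => h hP /=; have /exactD_mx/cid[h' h'E] : D k *m (a%:M - h *m D k) = 0.
    by rewrite mulmxBr mul_mx_scalar mulmxA hP subrr.
  have h'P : ok k.+1 h'.
    by rewrite /ok h'E mulmxBl mul_scalar_mx -mulmxA complexD mulmx0 subr0.
  by exists (exist _ h' h'P); rewrite /= h'E subrK.
have h0P : ok 0 h0 by rewrite /ok Dh0 mul_scalar_mx.
pose h := fix h k : {h | ok k h} :=
  if k is k'.+1 then sval (step k' (h k')) else exist _ h0 h0P.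
exists (fun k => sval (h k)); split=> // k.
exact: (svalP (step k (h k))).
Qed.

Definition congr0 (s : seq R) m n (A : 'M[R]_(m, n)) :=
  forall i j, A i j \in ideal_gen s.

Lemma congr0_mull s m n p (A : 'M[R]_(m, n)) (B : 'M_(n, p)) :
  congr0 s A -> congr0 s (A *m B).
Proof. by move=> sA i j; rewrite mxE; apply: rpred_sum => l _; apply: ideal_mulr. Qed.

Lemma congr0D s m n (A B : 'M[R]_(m, n)) :
  congr0 s A -> congr0 s B -> congr0 s (A + B).
Proof. by move=> sA sB i j; rewrite mxE; apply: rpredD. Qed.

Lemma congr0_rcons s a m n (A : 'M[R]_(m, n)) :
  congr0 (rcons s a) A -> exists B, congr0 s (A - a *: B).
Proof.
move=> sA; have /fin_all_exists[b bE] : forall i, exists b : 'rV_n,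
    forall j, A i j - b 0 j * a \in ideal_gen s.
  move=> i; have /fin_all_exists[b bE] : forall j, exists b,
      A i j - b * a \in ideal_gen s by move=> j; apply/ideal_gen_rcons.
  by exists (\row_j b j) => j; rewrite mxE.
by exists (\matrix_(i, j) b i 0 j) => i j; rewrite !mxE mulrC.
Qed.

(** Row vectors are the cochains of the dual complex, which starts in degree 0,
    where only 0 is a coboundary. *)
Definition coboundary s k : 'rV[R]_(r k) -> Prop :=
  match k with
  | 0 => fun v => congr0 s v
  | k'.+1 => fun v => exists u, congr0 s (v - u *m D k')
  end.

Definition weakly_regular (s : seq R) := forall k, (k < size s)%N -> forall y,
  s`_k * y \in ideal_gen (take k s) -> y \in ideal_gen (take k s).

(** The dual complex modulo the ideal of s has no cohomology in degrees below the
    number of remaining regular elements.  If a is the next one, the homotopy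
    writes a v as the coboundary of some u modulo s; then u is a cocycle modulo
    a and s, hence by induction a coboundary there, and replacing u by the
    multiple a w left over one can cancel a. *)
Lemma cocycle_coboundary k s t (v : 'rV[R]_(r k)) :
    weakly_regular (s ++ t) -> (k < size t)%N ->
    (forall a, a \in t -> null_homotopic a) ->
  congr0 s (v *m D k) -> coboundary s v.
Proof.
elim: k s t v => [|k IHk] s [//|a t] v reg lt_k nh Dv;
  have [h [h0E hE]] := nh a (mem_head _ _).
  have rega y : a * y \in ideal_gen s -> y \in ideal_gen s.
    have := reg (size s); rewrite size_cat -[ltnLHS]addn0 ltn_add2l => /(_ isT y).
    by rewrite nth_cat ltnn subnn take_size_cat.
  move=> i j; apply: rega; have : congr0 s (a *: v).
    by rewrite -mul_mx_scalar -h0E mulmxA; apply: congr0_mull.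
  by move/(_ i j); rewrite mxE.
have rega y : a * y \in ideal_gen s -> y \in ideal_gen s.
  have := reg (size s); rewrite size_cat -[ltnLHS]addn0 ltn_add2l => /(_ isT y).
  by rewrite nth_cat ltnn subnn take_size_cat.
pose u := v *m h k.
have avu : congr0 s (a *: v - u *m D k).
  rewrite -mul_mx_scalar -(hE k) mulmxDr !mulmxA addrK.
  by apply: congr0_mull.
have uD : congr0 (rcons s a) (u *m D k).
  have sub x : x \in ideal_gen s -> x \in ideal_gen (rcons s a).
    apply: ideal_gen_sub => y ys; apply: mem_ideal_gen.
    by rewrite mem_rcons inE ys orbT.
  move=> i j; rewrite -[_ i j](subKr ((a *: v) i j)); apply: rpredB.
    by rewrite mxE; apply/ideal_mulr/mem_ideal_gen; rewrite mem_rcons mem_head.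
  by apply: sub; have := avu i j; rewrite !mxE.
have {IHk} uB : coboundary (rcons s a) u.
  apply: (IHk _ t) => //; first by rewrite cat_rcons.
  by move=> b bt; apply: nh; rewrite inE bt orbT.
have [w wE] : exists w, congr0 s ((u - a *: w) *m D k).
  case: k {lt_k v Dv h h0E hE avu uD nh} u uB => [|k] u /=.
    by case/congr0_rcons=> w uw; exists w; apply: congr0_mull.
  case=> x /congr0_rcons[w xw]; exists w.
  have -> : (u - a *: w) *m D k.+1 = (u - x *m D k - a *: w) *m D k.+1.
    by rewrite !mulmxBl -[x *m _ *m _]mulmxA complexD mulmx0 subr0.
  exact: congr0_mull.
exists w => i j; apply: rega.
have : congr0 s (a *: v - u *m D k + (u - a *: w) *m D k) by apply: congr0D.
move/(_ i j); rewrite mulmxBl addrA subrK -scalemxAl -scalerBr.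
by rewrite [X in X \in _]mxE.
Qed.

End FreeResolution.


(** The composite of the comparison maps F -> P -> F is homotopic to the identity,
    and it is 0 in degree 3 because P vanishes there; the homotopy then splits
    D 2. *)
Lemma split_of_short_resolution (R : comNzRingType) (M : lmodType R)
    (r : nat -> nat) (D : forall k, 'M[R]_(r k, r k.+1))
    (e : {linear 'cV[R]_(r 0%N) -> M}) m :
    free_resolution D e -> (forall x : 'cV_(r 3%N), D 2%N *m x = 0 -> x = 0) ->
    proj_dim_le M m -> (m < 3)%N ->
  exists h : {linear 'cV[R]_(r 2%N) -> 'cV[R]_(r 3%N)}, forall x, h (D 2%N *m x) = x.
Proof.
case=> eS ex0 exD inj2 [P [d [e' [[e'S ex'0 exd] projP P0]]]] lt_m3.
have DD k (x : 'cV_(r k.+2)) : D k *m (D k.+1 *m x) = 0 by apply/exD; exists x.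
have eD (x : 'cV_(r 1%N)) : e (D 0%N *m x) = 0 by apply/ex0; exists x.
have dd k x : d k (d k.+1 x) = 0 by apply/exd; exists x.
have e'd x : e' (d 0%N x) = 0 by apply/ex'0; exists x.
(* The comparison maps from F to P use only that F is free. *)
have [a0 a0E] := free_lift (u := e') (f := e) (fun x => e'S _).
have [|a1 a1E] := free_lift (u := d 0%N) (f := a0 \o mulmx (D 0%N)).
  by move=> x; apply/ex'0; rewrite /= a0E eD.
have [|a2 a2E] := free_lift (u := d 1%N) (f := a1 \o mulmx (D 1%N)).
  by move=> x; apply/exd; rewrite /= a1E /= DD linear0.
have a2D (x : 'cV_(r 3%N)) : a2 (D 2%N *m x) = 0.
  have /exd[y <-] : d 1%N (a2 (D 2%N *m x)) = 0 by rewrite a2E /= DD linear0.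
  by rewrite [y]P0 // linear0.
(* Back from P to F, projectivity of P is used. *)
have [b0 b0E] := projP 0%N _ _ e e' eS.
have [|b1 b1E] := projective_lift (f := b0 \o d 0%N) (projP 1%N) ex0.
  by move=> x; rewrite /= b0E e'd.
have [|b2 b2E] := projective_lift (f := b1 \o d 1%N) (projP 2%N) (exD 0%N).
  by move=> x; rewrite /= b1E /= dd linear0.
(* A homotopy between the identity of F and the composite. *)
have [|h0 h0E] := free_lift (u := mulmx (D 0%N)) (f := idfun \- (b0 \o a0)).
  by move=> x; apply/ex0; rewrite /= linearB /= b0E a0E subrr.
have [|h1 h1E] := free_lift (u := mulmx (D 1%N))
    (f := (idfun \- (b1 \o a1)) \- (h0 \o mulmx (D 0%N))).
  move=> x; apply/exD; rewrite /= !mulmxBr.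
  have -> : D 0%N *m b1 (a1 x) = b0 (a0 (D 0%N *m x)) by rewrite b1E /= a1E.
  by rewrite h0E /= subrr.
have [|h2 h2E] := free_lift (u := mulmx (D 2%N))
    (f := (idfun \- (b2 \o a2)) \- (h1 \o mulmx (D 1%N))).
  move=> x; apply/exD; rewrite /= !mulmxBr.
  have -> : D 1%N *m b2 (a2 x) = b1 (a1 (D 1%N *m x)) by rewrite b2E /= a2E.
  by rewrite h1E /= DD linear0 subr0 subrr.
exists h2 => x; apply/eqP; rewrite -subr_eq0; apply/eqP/inj2.
by rewrite mulmxBr h2E /= a2D DD (linear0 b2) (linear0 h1) !subr0 subrr.
Qed.


(** * Perfection of the ideal *)

Section MainTheorem.
Variable n : nat.
Hypotheses (n_ge6 : (6 <= n)%N) (even_n : ~~ odd n).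
Local Notation R := (genring n).
Local Notation T := (genskew n).
Local Notation pf l := (pfaff (genskew n) (keep n l%N)).
Local Notation d := (partial1 n 0).

(** Evaluation at the origin, which detects the units that would have to occur
    among the entries of a split differential. *)
Definition at0 : R -> int := meval (fun=> 0).
HB.instance Definition _ := GRing.RMorphism.on at0.

Lemma at0_genskew i j : at0 (T i j) = 0.
Proof.
have at0_tau k l : at0 (tau k l) = 0.
  by rewrite /tau; case: insubP => [p _ _|_]; rewrite /at0 ?mevalXU ?meval0.
rewrite mxE; case: ifP => _; [|case: ifP => _]; rewrite ?rmorphN ?rmorph0 //=;
  by rewrite at0_tau ?oppr0.
Qed.

Lemma at0_pfaff s : s != [::] -> at0 (pfaff T s) = 0.
Proof.
case: s => // a s _; rewrite pfaff_cons.
elim: s (pfaff T) => [|b s IHs] g /=; first by rewrite rmorph0.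
by rewrite rmorphB rmorphM /= at0_genskew mul0r IHs subrr.
Qed.

Lemma at0_partial1 j : at0 (d j) = 0.
Proof.
rewrite (partial1E n_ge6 even_n) at0_pfaff // -size_eq0.
have [n1 n2 n3] : [/\ 0 < n, 1 < n & 2 < n]%N by split; lia.
by case: j => -[|[|[|[|//]]]] j4; rewrite size_keep //= ?n1 ?n2 ?n3 //; lia.
Qed.

Lemma at0_ideal s x : (forall y, y \in s -> at0 y = 0) ->
  x \in ideal_gen s -> at0 x = 0.
Proof.
move=> s0 /ideal_genP[c ->]; rewrite rmorph_sum big1 // => i _.
by rewrite rmorphM /= [X in _ * X]s0 ?mulr0 // mem_nth.
Qed.

Lemma partial1_in_idealA j : d j \in idealA n.
Proof. by apply/mem_ideal_gen/map_f; rewrite mem_enum. Qed.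

Lemma idealAP x : x \in idealA n <-> exists z, partial1 n *m z = x%:M.
Proof.
split=> [/ideal_genP[c ->]|[z zE]]; last first.
  have := congr1 (fun A : 'M_1 => A 0 0) zE; rewrite [RHS]mxE eqxx mulr1n => <-.
  rewrite mxE; apply: rpred_sum => j _; apply: ideal_mulr.
  exact: partial1_in_idealA.
have ex i : exists z, partial1 n *m z = (c i * [seq d j | j : 'I_4]`_i)%:M.
  have /mapP[j _ ->] : [seq d j | j : 'I_4]`_i \in [seq d j | j : 'I_4].
    exact: mem_nth.
  exists (c i *: delta_mx j 0); rewrite -scalemxAr -colE.
  by apply/matrixP => a b; rewrite !ord1 [LHS]mxE [X in _ * X]mxE [RHS]mxE eqxx mulr1n.
have [z zE] := fin_all_exists ex.
by exists (\sum_i z i); rewrite mulmx_sumr raddf_sum; apply: eq_bigr.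
Qed.

Lemma one_notin_idealA : 1 \notin idealA n.
Proof.
apply/negP => one_in; suff /eqP : at0 1 = 0 by rewrite rmorph1 oner_eq0.
by apply: at0_ideal one_in => y /mapP[j _ ->]; apply: at0_partial1.
Qed.

Let d0_neq0 := partial1_reg0 n_ge6 even_n.
Let reg1 := partial1_reg1 n_ge6 even_n.
Let reg2 := partial1_reg2 n_ge6 even_n.

Lemma F_rank0 k : (3 < k)%N -> forall x y : 'cV[R]_(F_rank n k), x = y.
Proof.
case: k => [|[|[|[|k]]]] // _; have : F_rank n k.+4 = 0%N := nth_nil _ k.
by move: (F_rank n k.+4) => m -> x y; apply/colP => -[].
Qed.

Lemma free_resolution_F : free_resolution (@F_diff n) (@quot_aug _ (idealA n)).
Proof.
split=> [u|v|].
- by have [x <-] := quot_pi_surj u; exists (const_mx x); rewrite /= /quot_aug mxE.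
- rewrite /= /quot_aug; have -> : (0 : quot_mod (idealA n)) = quot_pi (idealA n) 0.
    apply/esym; have := @quot_piD _ (idealA n) 0 0; rewrite addr0 => /esym/eqP.
    by rewrite -subr_eq0 addrK => /eqP.
  rewrite quot_pi_eq subr0; split=> [/idealAP[z zE]|[z zE]].
    by exists z; rewrite /= zE; apply/colP => i; rewrite ord1 mxE eqxx mulr1n.
  apply/idealAP; exists z; rewrite -[LHS]/(F_diff n 0 *m z) zE.
  by apply/colP => i; rewrite ord1 [RHS]mxE eqxx mulr1n.
case=> [|[|[|k]]] v.
- exact: exact_partial1.
- exact: exact_partial2.
- split=> [/(partial3_inj n_ge6 even_n d0_neq0)->|[u <-]].
    by exists 0; rewrite /= mul0mx.
  by rewrite /= mul0mx mulmx0.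
split=> _; first by exists 0; apply: F_rank0.
by rewrite (F_rank0 _ v 0) // linear0.
Qed.

Lemma regular_d012 : regular_seq [:: d 0; d 1; d 2].
Proof.
split.
  apply/negP => one_in; suff /eqP : at0 1 = 0 by rewrite rmorph1 oner_eq0.
  by apply: at0_ideal one_in => y; rewrite !inE => /or3P[]/eqP->; apply: at0_partial1.
case=> [|[|[|//]]] _ y /=.
- by rewrite !ideal_gen_nil mulf_eq0 (negbTE d0_neq0).
- exact: reg1.
exact: reg2.
Qed.

(** All entries of [partial3] vanish at the origin. *)
Lemma no_left_inverse (h : {linear 'cV[R]_n -> 'cV[R]_(n - 3)}) :
  ~ (forall x, h (partial3 n *m x) = x).
Proof.
move=> hP; have lt_0 : (0 < n - 3)%N by rewrite subn_gt0; lia.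
pose j := Ordinal lt_0; have /colP/(_ j)/(congr1 at0) := hP (delta_mx j 0).
rewrite mxE !eqxx rmorph1 -colE [col _ _]matrix_sum_delta linear_sum.
rewrite summxE rmorph_sum big1 => [/eqP|i _]; first by rewrite eq_sym oner_eq0.
rewrite big_ord1 linearZ mxE rmorphM /= [X in at0 X * _]mxE.
by rewrite [X in at0 X * _]mxE at0_genskew mul0r.
Qed.

Lemma pd_F : proj_dim_eq (quot_mod (idealA n)) 3.
Proof.
split.
  exists (fun k => 'cV[R]_(F_rank n k)), (fun k => mulmx (F_diff n k)).
  exists (@quot_aug _ (idealA n)); split; first exact: free_resolution_F.
    by move=> k; apply: projective_free.
  by move=> k lt_3k x; apply: F_rank0.
move=> m pdm; rewrite leqNgt; apply/negP => lt_m.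
have [|h hP] := split_of_short_resolution free_resolution_F _ pdm lt_m.
  exact: partial3_inj.
exact: no_left_inverse hP.
Qed.

Lemma grade_F : grade_eq (idealA n) 3.
Proof.
split.
  exists [:: d 0; d 1; d 2]; split=> //; last exact: regular_d012.
  by move=> y; rewrite !inE => /or3P[]/eqP->; apply: partial1_in_idealA.
move=> s sI [_ reg]; rewrite leqNgt; apply/negP => lt_s.
have exD k (v : 'cV[R]_(F_rank n k.+1)) :
    F_diff n k *m v = 0 <-> exists u, F_diff n k.+1 *m u = v.
  by case: free_resolution_F => _ _; apply.
have lt_0 : (0 < n - 3)%N by rewrite subn_gt0; lia.
pose j := Ordinal lt_0.
have [||a /sI/idealAP[z zE]|i l|u uE] := @cocycle_coboundary R (F_rank n) (@F_diff n)
  exD 3 [::] s (delta_mx 0 j).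
- exact: reg.
- exact: lt_s.
- exact: (@null_homotopy R (F_rank n) (@F_diff n) exD a z zE).
- by rewrite mulmx0 mxE rpred0.
have := uE 0 j; rewrite ideal_gen_nil => /eqP/(congr1 at0).
rewrite rmorph0 mxE [X in X + _]mxE [X in _ + X]mxE !eqxx [X in - X]mxE rmorphB rmorph1 /=.
rewrite rmorph_sum big1 ?subr0 => [/eqP|i _]; first by rewrite oner_eq0.
by rewrite rmorphM [X in _ * at0 X]mxE at0_genskew mulr0.
Qed.

End MainTheorem.

Theorem theorem2p9 (n : nat) (hn : (6 <= n)%N) (hn_even : ~~ odd n) :
  [/\ (forall x : 'cV[genring n]_(n - 3), partial3 n *m x = 0 -> x = 0),
      (forall y : 'cV[genring n]_n,
         partial2 n *m y = 0 <-> exists x, partial3 n *m x = y),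
      (forall z : 'cV[genring n]_4,
         partial1 n *m z = 0 <-> exists y, partial2 n *m y = z),
      free_resolution (@F_diff n) (@quot_aug _ (idealA n))
    & perfect_of_grade (idealA n) 3].
Proof.
split.
- exact: partial3_inj hn hn_even (partial1_reg0 hn hn_even).
- by apply: exact_partial2 => //; [apply: partial1_reg0|apply: partial1_reg1].
- by apply: exact_partial1 => //; [apply: partial1_reg0|apply: partial1_reg1|apply: partial1_reg2].
- exact: free_resolution_F.
split; [exact: one_notin_idealA|exact: grade_F|exact: pd_F].
Qed.
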